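(* Let $u_0\in H^1(0,1)$, let $\varepsilon\in(0,1)$, and let $u_0^\varepsilon\in H^1(0,1)$ satisfy $\|u_0^\varepsilon-u_0\|_{H^1(0,1)}\le\varepsilon$. Let $\beta=\beta(\varepsilon)\in(0,1)$ and let $\mathbf{P}_\varepsilon^\beta:H^1(0,1)\to L^2(0,1)$ be a stabilized operator. Then, for each such $\varepsilon$, the regularized problem $$\partial_x^2u_\beta^\varepsilon-\partial_y^2u_\beta^\varepsilon+\mathbf{P}_\varepsilon^\beta u_\beta^\varepsilon=0\ \text{ in }(0,1)\times(0,1),$$ $$u_\beta^\varepsilon(x,0)=u_\beta^\varepsilon(x,1)=0\ (x\in[0,1]),\qquad u_\beta^\varepsilon(0,y)=u_0^\varepsilon(y),\ \ \partial_xu_\beta^\varepsilon(0,y)=0\ (y\in[0,1])$$ admits a weak solution $u_\beta^\varepsilon$. Moreover, $u_\beta^\varepsilon\in C([0,1];H_0^1(0,1))$ and $\partial_xu_\beta^\varepsilon\in C([0,1];L^2(0,1))$.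
   Context: All functions are real-valued. $\|\cdot\|$ is the norm of $L^2(0,1)$ (in the variable $y$), and $\langle\cdot,\cdot\rangle$ is the $L^2(0,1)$ inner product or the duality pairing between $H^{-1}(0,1)$ and $H_0^1(0,1)$. Functions of $(x,y)$ are viewed as functions of $x\in[0,1]$ with values in function spaces in $y\in(0,1)$; $\mathbf{P}_\varepsilon^\beta$ acts in the variable $y$. Auxiliary function: $\gamma:(0,1)\to\mathbb{R}$ with $\gamma(\beta)\ge1$ for all $\beta\in(0,1)$ and $\lim_{\beta\to0}\gamma(\beta)=\infty$. The regularization parameter $\beta=\beta(\varepsilon)\in(0,1)$ satisfies $\beta\to0$ as $\varepsilon\to0$. Stabilized operator: a linear map $\mathbf{P}_\varepsilon^\beta:H^1(0,1)\to L^2(0,1)$ for which there is a constant $C_1>0$ independent of $\varepsilon$ with $\|\mathbf{P}_\varepsilon^\beta u\|\le C_1\log(\gamma(\beta))\|u\|_{H^1(0,1)}$ for all $u\in H^1(0,1)$. Weak solution: a function $u_\beta^\varepsilon:[0,1]\to H_0^1(0,1)$ such that (i) $u_\beta^\varepsilon\in C([0,1];H_0^1(0,1))$, $\partial_xu_\beta^\varepsilon\in C([0,1];L^2(0,1))$, $\partial_x^2u_\beta^\varepsilon\in L^2(0,1;H^{-1}(0,1))$; (ii) for every $\psi\in H_0^1(0,1)$, $\langle\partial_x^2u_\beta^\varepsilon,\psi\rangle+\langle\partial_yu_\beta^\varepsilon,\partial_y\psi\rangle+\langle\mathbf{P}_\varepsilon^\beta u_\beta^\varepsilon,\psi\rangle=0$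 for a.e. $x\in(0,1)$; (iii) $u_\beta^\varepsilon(0)=u_0^\varepsilon$ and $\partial_xu_\beta^\varepsilon(0)=0$.
   Formalization: The initial datum u_0^ε is additionally assumed to lie in H_0^1(0,1), not only H^1(0,1); this is necessary, as a weak solution has values in H_0^1(0,1) and equals u_0^ε at x=0 (for u_0=u_0^ε=1, P=0 none exists). *)

(* Defs.v *)
From HB Require Import structures.
From mathcomp Require Import all_boot all_order all_algebra.
From mathcomp Require Import all_classical all_reals all_analysis.

Set Implicit Arguments.
Unset Strict Implicit.
Unset Printing Implicit Defensive.

Import Order.TTheory GRing.Theory Num.Theory.
Import numFieldNormedType.Exports.

Local Open Scope classical_set_scope.
Local Open Scope ring_scope.

(** Functions of [y] are represented by total functions [R -> R] of which only
    the values on [`]0, 1[] matter; elements of L^2 and H^1 are therefore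
    representatives, and equality of elements is equality a.e. on [`]0, 1[].
    Functions of [(x, y)] are curried: [u x y], and [x] ranges over [`[0, 1]]
    (or [`]0, 1[], where the context says so). *)

Section Spaces.
Variable R : realType.
Implicit Types (f g u v phi psi : R -> R).

Local Notation mu := (@lebesgue_measure R).

Definition ae01 (Q : R -> Prop) : Prop :=
  {ae mu, forall y, y \in `]0, 1[%R -> Q y}.

Definition in_L2 f : Prop := (f \_ `]0, 1[ : measurableTypeR R -> R) \in Lfun mu 2%:E.

Definition L2norm f : R := fine ('N[mu]_2%:E[EFin \o (f \_ `]0, 1[)%R])%E.

Definition L2inner f g : R := \int[mu]_(y in `]0, 1[) (f y * g y).

(** C_c^oo(0,1) *)
Definition test_function phi : Prop :=
  [/\ forall n y, derivable (derive1n n phi) y 1,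
      compact (closure [set y | phi y != 0])
    & closure [set y | phi y != 0] `<=` `]0, 1[ ].

Definition weak_derivative u g : Prop :=
  forall phi, test_function phi -> L2inner u (derive1 phi) = - L2inner g phi.

Definition in_H1 u : Prop :=
  in_L2 u /\ exists g, in_L2 g /\ weak_derivative u g.

(** The weak derivative in L^2 (unique a.e.), or [0] if there is none. *)
Definition dy u : R -> R :=
  xget (cst 0 : R -> R) [set g | in_L2 g /\ weak_derivative u g].

Definition H1norm u : R := Num.sqrt (L2norm u ^+ 2 + L2norm (dy u) ^+ 2).

(** H_0^1(0,1) is the closure of C_c^oo(0,1) in H^1(0,1). *)
Definition in_H10 u : Prop :=
  in_H1 u /\
  forall e : R, 0 < e -> exists phi, test_function phi /\ H1norm (u \- phi) < e.

(** H^{-1}(0,1), the dual of H_0^1(0,1); only the values of [F] on H_0^1 matter,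
    and the duality pairing of [F] and [psi] is [F psi]. *)
Definition in_Hm1 (F : (R -> R) -> R) : Prop :=
  (forall (a : R) psi1 psi2, in_H10 psi1 -> in_H10 psi2 ->
     F (a \*o psi1 \+ psi2) = a * F psi1 + F psi2) /\
  (exists C : R, forall psi, in_H10 psi -> `|F psi| <= C * H1norm psi).

Definition Hm1norm (F : (R -> R) -> R) : R :=
  sup [set `|F psi| | psi in [set psi | in_H10 psi /\ H1norm psi <= 1]].

(** C([0,1]; S), for a space [S] of functions of [y] with norm [N]. *)
Definition in_C01 (S : (R -> R) -> Prop) (N : (R -> R) -> R)
    (u : R -> R -> R) : Prop :=
  forall x, x \in `[0, 1]%R ->
    S (u x) /\
    (fun s => N (u s \- u x)) @ within `[0, 1] (nbhs x) --> (0 : R).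

(** [v] is the derivative in [x] of the L^2-valued map [u] on [[0,1]]: the
    difference quotients converge in L^2 (from one side at the endpoints). *)
Definition is_dx (u v : R -> R -> R) : Prop :=
  forall x, x \in `[0, 1]%R ->
    (fun s => L2norm (fun y => (u s y - u x y) / (s - x) - v x y))
      @ within `[0, 1] (dnbhs x) --> (0 : R).

Definition simple_Hm1 (s : R -> (R -> R) -> R) : Prop :=
  exists (m : nat) (A : nat -> set (measurableTypeR R))
         (F : nat -> (R -> R) -> R),
    [/\ forall i, measurable (A i), forall i, in_Hm1 (F i)
      & forall x psi, s x psi = \sum_(i < m) \1_(A i) x * F i psi].

(** The Bochner space L^2(0,1; H^{-1}(0,1)). *)
Definition in_L2_Hm1 (w : R -> (R -> R) -> R) : Prop :=
  [/\ forall x, x \in `]0, 1[%R -> in_Hm1 (w x),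
      exists s : nat -> R -> (R -> R) -> R,
        (forall n, simple_Hm1 (s n)) /\
        ae01 (fun x =>
          (fun n => Hm1norm (fun psi => s n x psi - w x psi)) @ \oo --> (0 : R))
    & (\int[mu]_(x in `]0%R, 1%R[) (Hm1norm (w x) ^+ 2)%:E < +oo)%E].

(** [w] is the distributional derivative in [x] on [`]0, 1[] of the map [v],
    as H^{-1}-valued maps, [v x] in L^2 acting on H_0^1 by the L^2 inner product:
      int phi' v dx = - int phi w dx   in H^{-1}, for every phi in C_c^oo(0,1).
    This is written out at each [psi] in H_0^1, using that evaluation at [psi]
    commutes with the Bochner integral. *)
Definition is_weak_dx (v : R -> R -> R) (w : R -> (R -> R) -> R) : Prop :=
  forall phi psi, test_function phi -> in_H10 psi ->
    \int[mu]_(x in `]0, 1[) (derive1 phi x * L2inner (v x) psi) =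
    - \int[mu]_(x in `]0, 1[) (phi x * w x psi).

(** Linear maps H^1(0,1) -> L^2(0,1), well defined on a.e. classes. *)
Definition linear_H1_L2 (P : (R -> R) -> R -> R) : Prop :=
  [/\ forall u, in_H1 u -> in_L2 (P u),
      forall u v, in_H1 u -> in_H1 v ->
        ae01 (fun y => u y = v y) -> ae01 (fun y => P u y = P v y)
    & forall (a : R) u v, in_H1 u -> in_H1 v ->
        ae01 (fun y => P (a \*o u \+ v) y = a * P u y + P v y)].

(** The family of operators indexed by [eps] in (0,1), with [beta = beta(eps)];
    the constant [C1] is common to all [eps]. *)
Definition stabilized_operators (gamma beta : R -> R)
    (P : R -> (R -> R) -> R -> R) : Prop :=
  exists2 C1 : R, 0 < C1 &
    forall eps, 0 < eps < 1 ->
      linear_H1_L2 (P eps) /\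
      forall u, in_H1 u ->
        L2norm (P eps u) <= C1 * ln (gamma (beta eps)) * H1norm u.

(** Weak solution of
      u_xx - u_yy + P u = 0,  u(x,0) = u(x,1) = 0,  u(0,.) = u0,  u_x(0,.) = 0;
    the lateral boundary conditions are carried by H_0^1. *)
Definition weak_solution (P : (R -> R) -> R -> R) (u0 : R -> R)
    (u : R -> R -> R) : Prop :=
  exists (ux : R -> R -> R) (uxx : R -> (R -> R) -> R),
    [/\ in_C01 in_H10 H1norm u,
        is_dx u ux /\ in_C01 in_L2 L2norm ux,
        is_weak_dx ux uxx /\ in_L2_Hm1 uxx,
        forall psi, in_H10 psi ->
          ae01 (fun x =>
            uxx x psi + L2inner (dy (u x)) (dy psi) + L2inner (P (u x)) psi = 0)
      & ae01 (fun y => u 0 y = u0 y) /\ ae01 (fun y => ux 0 y = 0)].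

End Spaces.

(* Main.v *)
(** Write the problem as a first-order system [z' = G z] for [z = (u, u_x)] in
    [H_0^1 x L^2], with [G (u, v) = (v, u_yy - P u)] understood weakly.  The
    Dirichlet form plus the L^2 inner product is the H^1 inner product, so
    [<G z, z>] only sees [P - 1], which is bounded from H^1 to L^2: hence
    [<G z, z> <= c |z|^2].  The resolvent equation [z - h G z = z0] is solved
    for small [h] by Lax-Milgram, so implicit Euler is stable.  For data in the
    domain of [G^2], the Euler solutions with steps [h] and [h / 2] differ by
    O(h), hence converge uniformly along dyadic steps; data [(phi, 0)] with
    [phi] a test function lie in the domain of [G], and are approximated by one
    Euler step, and general data by density.  The limit solves the equation
    tested against the domain of the adjoint, and evaluating the difference
    quotient of [u] against itself makes it strongly differentiable in L^2.
    The functional [u_xx(x)] of H^{-1} is then defined by the equation.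

    The linearity of [dy] rests on the uniqueness of weak derivatives, which
    needs test functions converging to the indicator of an interval; they are
    products of translates and dilates of [exp (- 1 / t)]. *)

Require Import Defs.
From HB Require Import structures.
From mathcomp Require Import all_boot all_order all_algebra.
From mathcomp Require Import all_classical all_reals all_analysis.
From mathcomp Require Import measurable_realfun.
From mathcomp Require Import ring lra.
Import Order.TTheory GRing.Theory Num.Theory.
Import numFieldNormedType.Exports.
Local Open Scope classical_set_scope.
Local Open Scope ring_scope.

Set Implicit Arguments.
Unset Strict Implicit.
Unset Printing Implicit Defensive.

(** * Semi-inner product spaces *)

(** Functions are representatives, so the spaces below carry only semi-inner products: limits, Riesz
    representatives and fixed points are determined up to vectors of norm zero, and [dy] is linear
    only up to such vectors. Quotients are avoided by asking only for equalities of norms and of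
    pairings. For the same reason [G] is a relation and not a map: a weak second derivative is fixed
    only almost everywhere. The operator P has neither sign nor symmetry, so the energy may grow;
    what survives is the factor [expR (2 * b)] on the unit interval, uniform in the step size. The
    limit [Z] need not lie in the domain of [G], so the equation is kept only against functionals,
    with explicit bounds on them. The estimates are uniform over these functionals, so a functional
    may be chosen after the time at which it is evaluated; strong differentiability in L^2 needs
    exactly this freedom. Halving the step keeps the time grids nested, and the successive
    differences then sum geometrically. *)

Lemma discriminant_le (R : realFieldType) (A b c : R) : 0 <= A ->
  (forall t : R, 0 <= t ^+ 2 * A + 2 * t * b + c) -> b ^+ 2 <= A * c.
Proof.
rewrite le_eqVlt => /orP[/eqP <- h|A0 h].
  rewrite mul0r; have [->|b0] := eqVneq b 0; first by rewrite expr0n.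
  (* For [A = 0] the polynomial is affine in [t]; if [b] were nonzero, it would take the value -1 at
     this point. *)
  have := h (- (c + 1) / (2 * b)).
  suff -> : (- (c + 1) / (2 * b)) ^+ 2 * 0 + 2 * (- (c + 1) / (2 * b)) * b + c
    = -1 by lra.
  by field.
have := h (- b / A).
have -> : (- b / A) ^+ 2 * A + 2 * (- b / A) * b + c = (A * c - b ^+ 2) / A.
  by field; lra.
by rewrite pmulr_lge0 ?invr_gt0// subr_ge0.
Qed.

(** Replaces passages to the limit throughout: error terms are collected into one constant [c], of
    arbitrary sign, multiplying an arbitrarily small [d]. *)
Lemma le0_of_small (R : realFieldType) (x c : R) :
  (forall d : R, 0 < d -> x <= d * c) -> x <= 0.
Proof.
move=> h; rewrite leNgt; apply/negP => x0.
have h2 : 0 < `|c| + 1 by have := normr_ge0 c; lra.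
have := h (x / 2 / (`|c| + 1)); have x2 : 0 < x / 2 / (`|c| + 1).
  by rewrite !divr_gt0.
move=> /(_ x2); have : x / 2 / (`|c| + 1) * c <= x / 2.
  rewrite mulrAC ler_pdivrMr// ler_pM2l ?divr_gt0//.
  by have := ler_norm c; lra.
lra.
Qed.

Section SemiInnerProduct.
Variables (R : realType) (X : lmodType R) (B : X -> X -> R).

Definition semi_inner_product :=
  [/\ forall a x y z, B (a *: x + y) z = a * B x z + B y z,
      forall x y, B x y = B y x
    & forall x, 0 <= B x x].

Definition seminorm x := Num.sqrt (B x x).

(** Completeness without a topology on [X]: the Cauchy property comes with a modulus [e], and the
    limit is reached at the same modulus. The modulus is not assumed monotone, only to take
    arbitrarily small values. *)
Definition rate_complete :=
  forall (x : nat -> X) (e : nat -> R),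
    (forall d, 0 < d -> exists n, e n <= d) ->
    (forall n m, (n <= m)%N -> seminorm (x m - x n) <= e n) ->
    exists l, forall n, seminorm (x n - l) <= e n.

Definition linear_functional (l : X -> R) :=
  forall a x y, l (a *: x + y) = a * l x + l y.

Local Notation N := seminorm.

Section Functional.
Variables (l : X -> R) (hl : linear_functional l).

Lemma lfun0 : l 0 = 0.
Proof. by have := hl 1 0 0; rewrite scaler0 addr0; lra. Qed.

Lemma lfunZ a x : l (a *: x) = a * l x.
Proof. by rewrite -[a *: x]addr0 hl lfun0 addr0. Qed.

Lemma lfunD x y : l (x + y) = l x + l y.
Proof. by rewrite -[x in LHS]scale1r hl mul1r. Qed.

Lemma lfunN x : l (- x) = - l x.
Proof. by rewrite -scaleN1r lfunZ mulN1r. Qed.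

Lemma lfunB x y : l (x - y) = l x - l y.
Proof. by rewrite lfunD lfunN. Qed.

End Functional.

Hypothesis hB : semi_inner_product.

Lemma ipC x y : B x y = B y x. Proof. by case: hB. Qed.
Lemma ip_ge0 x : 0 <= B x x. Proof. by case: hB. Qed.
Lemma ip_linl z : linear_functional (B^~ z).
Proof. by move=> a x y; case: hB => ->. Qed.
Lemma ip_linr z : linear_functional (B z).
Proof. by move=> a x y; rewrite !(ipC z); case: hB => ->. Qed.

Lemma ipDl z x y : B (x + y) z = B x z + B y z.
Proof. exact: (lfunD (ip_linl z)). Qed.
Lemma ipDr z x y : B z (x + y) = B z x + B z y.
Proof. exact: (lfunD (ip_linr z)). Qed.
Lemma ipNl z x : B (- x) z = - B x z.
Proof. exact: (lfunN (ip_linl z)). Qed.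
Lemma ipNr z x : B z (- x) = - B z x.
Proof. exact: (lfunN (ip_linr z)). Qed.
Lemma ipBl z x y : B (x - y) z = B x z - B y z.
Proof. exact: (lfunB (ip_linl z)). Qed.
Lemma ipZl z a x : B (a *: x) z = a * B x z.
Proof. exact: (lfunZ (ip_linl z)). Qed.
Lemma ipZr z a x : B z (a *: x) = a * B z x.
Proof. exact: (lfunZ (ip_linr z)). Qed.

Lemma snorm_ge0 x : 0 <= N x. Proof. exact: sqrtr_ge0. Qed.
Hint Resolve snorm_ge0 : core.

Lemma sqr_snorm x : N x ^+ 2 = B x x.
Proof. by rewrite sqr_sqrtr// ip_ge0. Qed.

Lemma ip_CS x y : `|B x y| <= N x * N y.
Proof.
rewrite -ler_sqr ?nnegrE ?mulr_ge0// real_normK ?num_real// exprMn !sqr_snorm.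
apply: discriminant_le; first exact: ip_ge0.
move=> t; have := ip_ge0 (t *: x + y).
rewrite !ipDl !ipDr !ipZl !ipZr (ipC y x); lra.
Qed.

Lemma ip_le x y : B x y <= N x * N y.
Proof. exact: le_trans (ler_norm _) (ip_CS x y). Qed.

Lemma snormD x y : N (x + y) <= N x + N y.
Proof.
rewrite -ler_sqr ?nnegrE ?addr_ge0// sqr_snorm ipDl !ipDr (ipC y x).
have := ip_le x y; rewrite sqrrD !sqr_snorm; lra.
Qed.

Lemma snormZ a x : N (a *: x) = `|a| * N x.
Proof.
by rewrite /seminorm ipZl ipZr mulrA -expr2 sqrtrM ?sqr_ge0// sqrtr_sqr.
Qed.

Lemma snormN x : N (- x) = N x.
Proof. by rewrite -scaleN1r snormZ normrN normr1 mul1r. Qed.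

Lemma snormBC x y : N (x - y) = N (y - x).
Proof. by rewrite -snormN opprB. Qed.

Lemma snorm0 : N 0 = 0.
Proof. by rewrite -(scale0r (0 : X)) snormZ normr0 mul0r. Qed.

Lemma snorm_dist y x z : N (x - z) <= N (x - y) + N (y - z).
Proof. by rewrite -[x - z](subrKA y); exact: snormD. Qed.

Lemma snorm_le_dist x y : N x <= N y + N (x - y).
Proof. by rewrite -{1}[x](subrK y) addrC; exact: snormD. Qed.

Lemma ip_snorm0 x y : N x = 0 -> B x y = 0.
Proof.
by move=> x0; apply/eqP; rewrite -normr_eq0 eq_le normr_ge0 andbT
  (le_trans (ip_CS x y))// x0 mul0r.
Qed.

(** The bound reproduces itself, since [(1 - r) * e n + e n.+1 = e n]; no geometric series has to be
    summed. *)
Lemma geometric_cauchy (r : R) (x : nat -> X) (e : nat -> R) :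
  (forall n, N (x n.+1 - x n) <= (1 - r) * e n) -> (forall n, e n.+1 = r * e n) ->
  0 <= r -> (forall n, 0 <= e n) ->
  forall n m, (n <= m)%N -> N (x m - x n) <= e n.
Proof.
move=> h1 h2 r0 e0 n m /subnK <-; move: (m - n)%N => k {m}; elim: k n => [|k IH] n.
  by rewrite subrr snorm0.
rewrite addSnnS; apply: (le_trans (snorm_dist (x n.+1) _ _)).
by have := IH n.+1; have := h1 n; rewrite h2; lra.
Qed.

Hypothesis complB : rate_complete.

(* Minimize the energy |w|^2 - 2 l(w): minimizing sequences are Cauchy by the
   parallelogram identity. *)
Lemma riesz (l : X -> R) C : linear_functional l -> (forall x, `|l x| <= C * N x) ->
  exists u, forall w, B u w = l w.
Proof.
move=> hl hC; pose J w := B w w - 2 * l w.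
have Jlb w : - C ^+ 2 <= J w.
  have := hC w; rewrite /J -sqr_snorm => /(le_trans (ler_norm _)).
  have := sqr_ge0 (N w - C); lra.
have hinf : has_inf (range J).
  by split; [exists (J 0), 0|exists (- C ^+ 2) => _ [w _ <-]].
set m := inf (range J).
have Jm w : m <= J w by apply: ge_inf; [case: hinf|exists w].
pose d (n : nat) : R := n.+1%:R^-1.
have d0 n : 0 < d n by rewrite invr_gt0.
have dmono n k : (n <= k)%N -> d k <= d n.
  by move=> nk; rewrite lef_pV2 ?posrE// ler_nat.
have /choice [x hx] : forall n, exists w, J w < m + d n ^+ 2.
  move=> n; have [|_ [w _ <-] ?] := @inf_adherent _ (range J) (d n ^+ 2) _ hinf.
    by rewrite exprn_gt0.
  by exists w.
(* The midpoint of [x k] and [x n] has energy at least [m], so the squared distance is at most 2 J(x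
   k) + 2 J(x n) - 4 m, hence at most [4 * d n ^+ 2]. *)
have [|n k nk|u hu] := @complB x (fun n => 2 * d n).
- move=> e e0; exists (Num.truncn (2 / e)); rewrite /d.
  rewrite ler_pdivrMr// mulrC -ler_pdivrMr//.
  by apply: ltW; rewrite truncnS_gt.
- rewrite -ler_sqr ?nnegrE ?mulr_ge0 ?(ltW (d0 _))// sqr_snorm.
  have := Jm (2^-1 *: (x k + x n)); have := hx k; have := hx n.
  rewrite /J !(ipDl, ipDr, ipNl, ipNr, ipZl, ipZr) (lfunZ hl) (lfunD hl).
  have : d k ^+ 2 <= d n ^+ 2 by rewrite ler_sqr ?nnegrE ?(ltW (d0 _))// dmono.
  by rewrite (ipC (x n) (x k)); lra.
exists u => w; apply/eqP; rewrite -subr_eq0 -normr_eq0 eq_le normr_ge0 andbT.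
have hn n : `|B u w - l w| <= d n * (3 * N w).
  (* The first variation at an almost minimizer: J(x n + t w) exceeds J(x n) - (d n)^2 for every
     [t], and the discriminant of this polynomial in [t] is the claim. Adding the distance [2 * d n]
     to [u] gives the factor 3. *)
  have h1 : `|B (x n) w - l w| <= d n * N w.
    rewrite -ler_sqr ?nnegrE ?mulr_ge0 ?(ltW (d0 _))// real_normK ?num_real//.
    rewrite exprMn mulrC sqr_snorm; apply: discriminant_le => [|t].
      exact: ip_ge0.
    have := Jm (x n + t *: w); have := hx n.
    rewrite /J !(ipDl, ipDr, ipNl, ipNr, ipZl, ipZr) (lfunD hl) (lfunZ hl).
    by rewrite (ipC w (x n)); lra.
  have h2 : `|B (u - x n) w| <= 2 * d n * N w.
    apply: le_trans (ip_CS _ _) _; rewrite ler_wpM2r//.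
    by rewrite snormBC.
  rewrite ipBl in h2.
  have -> : B u w - l w = (B u w - B (x n) w) + (B (x n) w - l w) by lra.
  by apply: le_trans (ler_normD _ _) _; lra.
apply: (@le0_of_small _ _ (3 * N w)) => e e0.
apply: (le_trans (hn (Num.truncn e^-1))); rewrite ler_wpM2r ?mulr_ge0//.
by rewrite /d invf_ple ?posrE// ltW// truncnS_gt.
Qed.

Lemma contraction_fixpoint (T : X -> X) (k : R) : 0 <= k < 1 ->
  (forall x y, N (T x - T y) <= k * N (x - y)) -> exists x, N (T x - x) = 0.
Proof.
move=> /andP[k0 k1] hT; pose x n := iter n T 0.
pose D := N (T 0 - 0) / (1 - k).
have k'0 : 0 < 1 - k by rewrite subr_gt0.
have D0 : 0 <= D by rewrite divr_ge0// ltW.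
have hx n : N (x n.+1 - x n) <= (1 - k) * (k ^+ n * D).
  elim: n => [|n IH].
    by rewrite /x /D /= expr0 mul1r mulrC divfK// lt0r_neq0.
  apply: le_trans (hT _ _) _; rewrite exprS.
  by have := ler_wpM2l k0 IH; rewrite -!mulrA [k * ((1 - k) * _)]mulrCA.
have small d : 0 < d -> exists n, k ^+ n * D <= d.
  move=> d0.
  have : (fun n => k ^+ n * D) @ \oo --> (0 * D : R).
    apply: cvgMl; apply: cvg_expr; by rewrite ger0_norm.
  rewrite mul0r => /cvgr0Pnorm_le /(_ _ d0)[n _ /(_ n (leqnn n))] h.
  by exists n; apply: le_trans (ler_norm _) h.
have [|l hl] := @complB x (fun n => k ^+ n * D) small.
  apply: (geometric_cauchy (r := k)) => // n; first by rewrite exprS mulrA.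
  by rewrite mulr_ge0// exprn_ge0.
exists l; apply/eqP; rewrite eq_le snorm_ge0 andbT.
apply: (@le0_of_small _ _ 2) => d /small[n hn].
apply: le_trans (snorm_dist (x n.+1) _ _) _.
have h1 : N (T l - x n.+1) <= k * (k ^+ n * D).
  by apply: le_trans (hT _ _) _; rewrite ler_wpM2l// snormBC.
have := hl n.+1; rewrite exprS.
have : k * (k ^+ n * D) <= k ^+ n * D.
  by apply: ler_piMl; rewrite ?(ltW k1)// mulr_ge0 ?exprn_ge0.
by move: h1; rewrite -mulrA; lra.
Qed.

Lemma lax_milgram (a : X -> X -> R) (M al : R) (l : X -> R) C :
  (forall x, linear_functional (a x)) -> (forall y, linear_functional (a^~ y)) ->
  (forall x y, `|a x y| <= M * N x * N y) -> 0 < al ->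
  (forall x, al * N x ^+ 2 <= a x x) ->
  linear_functional l -> (forall x, `|l x| <= C * N x) ->
  exists u, forall w, a u w = l w.
Proof.
move=> ar al_ aM al0 acoer hl hC.
pose M' : R := `|M| + al; have M'0 : 0 < M' by rewrite ltr_wpDl.
have aM' x y : `|a x y| <= M' * N x * N y.
  apply: le_trans (aM x y) _; rewrite -!mulrA ler_wpM2r ?mulr_ge0//.
  by have := ler_norm M; rewrite /M'; lra.
have [f hf] := riesz hl hC.
(* [S] represents the form [a] but is an arbitrary choice of representatives, so it need not be
   linear; below it enters only through its pairings [B (S u) w]. *)
have /choice [S hS] : forall u, exists s, forall w, B s w = a u w.
  by move=> u; apply: (riesz (ar u)) => x; exact: aM'.
(* This [rho] minimizes 1 - 2 rho al + rho^2 M'^2, the bound for the squared Lipschitz constant of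
   [T]; the minimum is [k2]. The choice of [M'] ensures al <= M', so that [k2] is nonnegative. *)
pose rho := al / M' ^+ 2.
pose T u := u - rho *: (S u - f).
pose k2 := 1 - (al / M') ^+ 2.
have aM1 : al / M' <= 1 by rewrite ler_pdivrMr// mul1r /M' lerDr.
have aM0 : 0 < al / M' by rewrite divr_gt0.
have k20 : 0 <= k2.
  by rewrite /k2 subr_ge0 expr_le1// ltW.
have k21 : k2 < 1 by rewrite /k2 ltrBlDr ltrDl exprn_gt0.
have [||u hu] := @contraction_fixpoint T (Num.sqrt k2).
- by rewrite sqrtr_ge0 -sqrtr1 ltr_sqrt.
- move=> u v.
  rewrite -ler_sqr ?nnegrE ?mulr_ge0 ?sqrtr_ge0// exprMn (sqr_sqrtr k20).
  set d := u - v; set s := S u - S v.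
  have -> : T u - T v = d - rho *: s.
    have -> : s = (S u - f) - (S v - f) by rewrite opprB addrA subrK.
    rewrite scalerBr /T /d; set p := rho *: _; set q := rho *: _.
    by rewrite [- (v - q)]opprD [- (p - q)]opprD !opprK addrACA.
  have hs w : B s w = a d w by rewrite ipBl !hS (lfunB (al_ w)).
  have Ns : N s <= M' * N d.
    have [->|s0] := eqVneq (N s) 0; first by rewrite mulr_ge0// ltW.
    have s1 : 0 < N s by rewrite lt_neqAle eq_sym s0 snorm_ge0.
    rewrite -(ler_pM2r s1) -expr2 sqr_snorm hs.
    exact: le_trans (ler_norm _) (aM' d s).
  have Ns2 : N s ^+ 2 <= M' ^+ 2 * N d ^+ 2.
    by rewrite -exprMn ler_sqr ?nnegrE ?mulr_ge0// ltW.
  have sqrB (d' s' : X) : N (d' - rho *: s') ^+ 2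
      = N d' ^+ 2 - 2 * rho * B s' d' + rho ^+ 2 * N s' ^+ 2.
    by rewrite !sqr_snorm !(ipDl, ipDr, ipNl, ipNr, ipZl, ipZr) (ipC d' s'); ring.
  rewrite sqrB hs.
  have h1 := acoer d.
  have h2 : rho ^+ 2 * N s ^+ 2 <= rho * al * N d ^+ 2.
    have -> : rho * al * N d ^+ 2 = rho ^+ 2 * (M' ^+ 2 * N d ^+ 2).
      by rewrite /rho; field; rewrite lt0r_neq0.
    by rewrite ler_wpM2l ?sqr_ge0.
  have h3 : rho * (al * N d ^+ 2) <= rho * a d d.
    by rewrite ler_wpM2l// /rho divr_ge0 ?exprn_ge0// ltW.
  have -> : k2 = 1 - rho * al by rewrite /k2 /rho; field; rewrite lt0r_neq0.
  lra.
exists u => w; rewrite -hS -hf; apply/eqP; rewrite -subr_eq0 -ipBl.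
move: hu; rewrite /T addrAC subrr sub0r snormN snormZ => /eqP.
have rho0 : 0 < rho by rewrite divr_gt0// exprn_gt0.
rewrite mulf_eq0 normr_eq0 (gt_eqF rho0)/= => /eqP h; exact/eqP/ip_snorm0.
Qed.

End SemiInnerProduct.

(** * Flows of quasi-dissipative linear relations *)

Section QuasiDissipative.
Variables (R : realType) (X : lmodType R) (B : X -> X -> R).
Hypothesis hB : semi_inner_product B.
Local Notation N := (seminorm B).
Let N_ge0 x : 0 <= N x := snorm_ge0 B x.
Local Hint Resolve N_ge0 : core.

Variables (G : X -> X -> Prop) (b : R).
Hypothesis b0 : 0 < b.
Hypothesis G_lin : forall a x x' y y',
  G x x' -> G y y' -> G (a *: x + y) (a *: x' + y').
Hypothesis G_diss : forall x x', G x x' -> B x' x <= b * N x ^+ 2.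

(** The growth over unit time: under [h * b <= 2^-1], one implicit step amplifies by at most exp(2 h
    b), and there are [n] steps with [h * n%:R <= 1]. *)
Let K := expR (2 * b).

Definition trajectory h (d : nat -> X) :=
  forall n, G (d n.+1) (h^-1 *: (d n.+1 - d n)).

(** The slope at index 0 is a prescribed image [z1] of the initial point. With this convention the
    slopes of a trajectory form a trajectory again, so second differences are bounded by applying
    the same stability estimate twice. *)
Definition trajectory_slope h (d : nat -> X) z1 n :=
  if n is m.+1 then h^-1 *: (d m.+1 - d m) else z1.

Lemma relation_sub x x' y y' : G x x' -> G y y' -> G (x - y) (x' - y').
Proof.
move=> hx hy; rewrite addrC [_ - y']addrC -scaleN1r -[- y']scaleN1r.
exact: G_lin.
Qed.

Lemma relation_scale a x x' : G x x' -> G (a *: x) (a *: x').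
Proof.
move=> hx; have h0 := relation_sub hx hx; rewrite !subrr in h0.
by have := G_lin a hx h0; rewrite !addr0.
Qed.

(** Pair the identity e = e0 + h e' + r with [e], use dissipativity on the middle term and
    Cauchy-Schwarz on the others, then divide by [N e]. *)
Lemma step_bound h e e' e0 r : 0 < h -> G e e' -> e - e0 = h *: e' + r ->
  (1 - h * b) * N e <= N e0 + N r.
Proof.
move=> h0 Gee heq; have [->|e1] := eqVneq (N e) 0; first by rewrite mulr0 addr_ge0.
have Ne : 0 < N e by rewrite lt_neqAle eq_sym e1 N_ge0.
rewrite -(ler_pM2r Ne).
have /(congr1 (fun x => B x e)) : e = e0 + h *: e' + r.
  by rewrite -addrA -heq addrC subrK.
rewrite -[in LHS](sqr_snorm hB) !(ipDl hB) (ipZl hB).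
have := ler_wpM2l (ltW h0) (G_diss Gee).
have := ip_le hB e0 e; have := ip_le hB r e.
by rewrite !mulrA; lra.
Qed.

Lemma discrete_gronwall (al : nat -> R) h c : 0 < h -> h * b <= 2^-1 -> 0 <= c ->
  (forall n, 0 <= al n) ->
  (forall n, h * n.+1%:R <= 1 -> (1 - h * b) * al n.+1 <= al n + h * c) ->
  forall n, h * n%:R <= 1 -> al n <= K * (al 0%N + c).
Proof.
move=> h0 hb c0 al0 hal n hn; pose E := expR (2 * (h * b)).
have hb0 : 0 < h * b by rewrite mulr_gt0.
(* For s = h b in [0, 1/2] one has (1 - s)(1 + 2 s) = 1 + s (1 - 2 s) >= 1; this is where the
   threshold 1/2 on [h * b] comes from. *)
have E1 : 1 <= (1 - h * b) * E.
  have : 1 + 2 * (h * b) <= E by exact: expR_ge1Dx.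
  have : 0 < 1 - h * b by lra.
  move=> /ltW h1 /(ler_wpM2l h1); apply: le_trans; nra.
have E0 : 0 < E by exact: expR_gt0.
have E11 : 1 <= E by rewrite -expR0 ler_expR; lra.
have : al n <= E ^+ n * (al 0%N + h * n%:R * c).
  elim: n hn => [|n IH] hn; first by rewrite expr0 !(mul1r, mulr0, mul0r) addr0.
  have hn' : h * n%:R <= 1.
    by apply: le_trans hn; rewrite ler_wpM2l ?(ltW h0)// ler_nat.
  have {}IH := IH hn'.
  have En : 1 <= E ^+ n by rewrite exprn_ege1.
  have h1 : al n.+1 <= E * (al n + h * c).
    apply: le_trans (_ : E * ((1 - h * b) * al n.+1) <= _).
      rewrite mulrA [E * _]mulrC ler_peMl//.
    by rewrite ler_pM2l//; exact: hal.
  apply: (le_trans h1); rewrite exprS -mulrA ler_pM2l//.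
  apply: le_trans (_ : E ^+ n * (al 0%N + h * n%:R * c) + E ^+ n * (h * c) <= _).
    apply: lerD => //; rewrite ler_peMl// mulr_ge0// ltW//.
  by rewrite -mulrDr -natr1 le_eqVlt; apply/orP; left; apply/eqP; ring.
move=> /le_trans; apply.
apply: ler_pM => //.
- exact/exprn_ge0/ltW.
- by rewrite addr_ge0// !mulr_ge0// ltW.
- rewrite /E -expRM_natr /K ler_expR -mulrA ler_pM2l//.
  have := ler_wpM2l (ltW b0) hn; lra.
- by rewrite lerD2l ler_piMl.
Qed.

Lemma trajectory_bound h d : 0 < h -> h * b <= 2^-1 -> trajectory h d ->
  forall n, h * n%:R <= 1 -> N (d n) <= K * N (d 0%N).
Proof.
move=> h0 hb hd n hn; rewrite -[N (d 0%N)]addr0.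
apply: (@discrete_gronwall (fun n => N (d n)) h 0) => // k _.
rewrite mulr0 -(snorm0 hB); apply: (step_bound h0 (hd k)).
by rewrite addr0 scalerA divff ?scale1r// gt_eqF.
Qed.

Lemma trajectory_slopeE h d z1 n : 0 < h ->
  d n.+1 - d n = h *: trajectory_slope h d z1 n.+1.
Proof. by move=> h0; rewrite scalerA divff ?scale1r// gt_eqF. Qed.

Lemma trajectory_slope_rel h d z1 n :
  trajectory h d -> G (d 0%N) z1 -> G (d n) (trajectory_slope h d z1 n).
Proof. by case: n => [|n] //= hd _; exact: hd. Qed.

Lemma trajectory_slope_trajectory h d z1 : trajectory h d -> G (d 0%N) z1 ->
  trajectory h (trajectory_slope h d z1).
Proof.
move=> hd h1 n; have := relation_scale h^-1
  (relation_sub (trajectory_slope_rel n.+1 hd h1) (trajectory_slope_rel n hd h1)).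
by [].
Qed.

(** Two half steps differ from one full step by a second difference of [c], of size h^2 / 4 times
    the slope of the slopes. Bounding that slope uniformly in [h] is what requires initial data with
    a second image [z2]. *)
Lemma trajectory_refine h a c z1 z2 : 0 < h -> h * b <= 2^-1 ->
  trajectory h a -> trajectory (h / 2) c -> a 0%N = c 0%N ->
  G (c 0%N) z1 -> G z1 z2 ->
  forall n, h * n%:R <= 1 -> N (c (2 * n)%N - a n) <= K ^+ 2 * N z2 * h.
Proof.
move=> h0 hb ha hc ac Gz1 Gz2 n hn.
have h20 : 0 < h / 2 by rewrite divr_gt0.
have hb2 : h / 2 * b <= 2^-1 by have := mulr_gt0 h0 b0; lra.
have Gz1' : G (a 0%N) z1 by rewrite ac.
pose p := trajectory_slope (h / 2) c z1.
pose q := trajectory_slope (h / 2) p z2.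
have tp : trajectory (h / 2) p by exact: trajectory_slope_trajectory.
have tq : trajectory (h / 2) q by exact: trajectory_slope_trajectory.
have K1 : 1 <= K by rewrite -expR0 ler_expR; have := b0; lra.
pose e n := c (2 * n)%N - a n.
apply: le_trans (@discrete_gronwall (fun n => N (e n)) h
  (h / 4 * (K * N z2)) h0 hb _ _ _ n hn) _.
- by rewrite !mulr_ge0// ?ltW ?divr_gt0// (lt_le_trans _ K1).
- by [].
- move=> k hk.
  (* Two half steps advance by h / 2 times the sum of two consecutive slopes; [r] is the cost of
     replacing the earlier slope by the later one, at which the relation is evaluated. *)
  pose r := - (h / 2 * (h / 2)) *: q (2 * k.+1)%N.
  have hh : 0 <= h / 2 * (h / 2) by rewrite mulr_ge0// ltW.
  have Nr : N r <= h * (h / 4 * (K * N z2)).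
    rewrite /r (snormZ hB) normrN ger0_norm//.
    rewrite [leRHS]mulrA; have -> : h * (h / 4) = h / 2 * (h / 2) by field.
    rewrite ler_wpM2l//.
    apply: (trajectory_bound h20 hb2 tq (n := (2 * k.+1)%N)).
    by rewrite natrM mulrA divfK.
  apply: le_trans (lerD (lexx _) Nr).
  apply: (step_bound (e' := p (2 * k.+1)%N - trajectory_slope h a z1 k.+1) h0).
    by apply: relation_sub; apply: trajectory_slope_rel.
  rewrite scalerBr -(trajectory_slopeE _ _ _ h0) /e.
  rewrite /r (_ : (2 * k.+1)%N = (2 * k).+2); last by rewrite mulnS.
  have e2 : p (2 * k).+1 = p (2 * k).+2 - (h / 2) *: q (2 * k).+2.
    apply/eqP; rewrite eq_sym subr_eq addrC -subr_eq.
    by rewrite (trajectory_slopeE _ z2 _ h20).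
  have e3 : c (2 * k).+2 - c (2 * k)%N
      = h *: p (2 * k).+2 - (h / 2 * (h / 2)) *: q (2 * k).+2.
    rewrite -(subrKA (c (2 * k).+1)).
    rewrite !(trajectory_slopeE _ z1 _ h20) -/p [in X in _ + X]e2.
    by rewrite scalerBr addrA -scalerDl -splitr -[in RHS]scalerA.
  rewrite scaleNr [RHS]addrAC -e3 [- (c _ - _)]opprD [- (a _ - _)]opprD !opprK.
  by rewrite addrACA.
rewrite /e muln0 ac subrr (snorm0 hB) add0r.
have : 0 <= K ^+ 2 * N z2 * h by rewrite mulr_ge0 ?(ltW h0)// mulr_ge0// sqr_ge0.
have -> : K * (h / 4 * (K * N z2)) = (K ^+ 2 * N z2 * h) / 4 by field.
lra.
Qed.

Hypothesis G_range : forall h, 0 < h -> h * b <= 2^-1 ->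
  forall z0, exists z, G z (h^-1 *: (z - z0)).

Definition bounded_functional (C : R) (l : X -> R) :=
  [/\ linear_functional l, 0 <= C & forall x, `|l x| <= C * N x].

(* [xi] lies in the domain of the adjoint of [G], with image [xi']. *)
Definition dual_pair (C : R) (xi xi' : X -> R) :=
  [/\ exists D, bounded_functional D xi, bounded_functional C xi'
    & forall x x', G x x' -> xi x' = xi' x].

Definition flow_continuous (Z : R -> X) := forall s e, 0 <= s <= 1 -> 0 < e ->
  exists2 d, 0 < d &
    forall t, 0 <= t <= 1 -> `|t - s| <= d -> N (Z t - Z s) <= e.

(* A quantified form of [(xi (Z t))' = xi' (Z t)] which is preserved by uniform
   limits. *)
Definition flow_derivative (Z : R -> X) := forall C xi xi', dual_pair C xi xi' ->
  forall s t e, 0 <= s -> s <= t -> t <= 1 ->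
  (forall r, s <= r <= t -> N (Z r - Z s) <= e) ->
  `|xi (Z t) - xi (Z s) - (t - s) * xi' (Z s)| <= (t - s) * (C * e).

Definition flow Z := flow_continuous Z /\ flow_derivative Z.

Lemma flow_limit Z :
  (forall d, 0 < d -> exists2 Y, flow Y &
    forall t, 0 <= t <= 1 -> N (Y t - Z t) <= d) -> flow Z.
Proof.
move=> hZ; split=> [s e hs e0|C xi xi' hxi s t e s0 st t1 he].
  have e3 : 0 < e / 3 by rewrite divr_gt0.
  have [Y [Yc _] YZ] := hZ _ e3.
  have [d d0 hd] := Yc s (e / 3) hs e3.
  exists d => // t ht td.
  apply: le_trans (snorm_dist hB (Y t) _ _) _.
  apply: le_trans (lerD (lexx _) (snorm_dist hB (Y s) _ _)) _.
  have := YZ t ht; have := YZ s hs; have := hd t ht td.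
  by rewrite (snormBC hB (Z t)); lra.
have [[D [xil D0 xiD]] [xil' C0 xiC] _] := hxi.
(* Replacing [Y] by [Z] costs [D * d] in each of the two values of [xi] and [(t - s) * (C * d)] in
   the slope term; the oscillation of [Y] exceeds that of [Z] by at most [2 * d]. *)
rewrite -subr_le0; apply: (@le0_of_small _ _ (2 * D + (t - s) * C + (t - s) * (C * 2))).
move=> d /hZ[Y [_ Yd] YZ].
have hs : 0 <= s <= 1 by rewrite s0 (le_trans st).
have ht : 0 <= t <= 1 by rewrite t1 andbT (le_trans s0).
have ts : 0 <= t - s by rewrite subr_ge0.
have := Yd _ _ _ hxi s t (e + 2 * d) s0 st t1.
have h1 r : s <= r <= t -> N (Y r - Y s) <= e + 2 * d.
  move=> hr; have hr1 : 0 <= r <= 1.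
    by case/andP: hr => h1 h2; rewrite (le_trans s0 h1) (le_trans h2).
  apply: le_trans (snorm_dist hB (Z r) _ _) _.
  apply: le_trans (lerD (lexx _) (snorm_dist hB (Z s) _ _)) _.
  have := YZ r hr1; have := YZ s hs; have := he r hr.
  by rewrite (snormBC hB (Z s)); lra.
move=> /(_ h1) h2.
have xid r : 0 <= r <= 1 -> `|xi (Y r) - xi (Z r)| <= D * d.
  move=> hr; rewrite -(lfunB xil); apply: le_trans (xiD _) _.
  by apply: ler_wpM2l => //; exact: YZ.
have xid' : `|(t - s) * xi' (Y s) - (t - s) * xi' (Z s)| <= (t - s) * (C * d).
  rewrite -mulrBr -(lfunB xil') normrM (ger0_norm ts) ler_wpM2l//.
  by apply: le_trans (xiC _) _; apply: ler_wpM2l => //; exact: YZ.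
have := xid t ht; have := xid s hs.
move: xid' h2; rewrite !ler_norml => /andP[? ?] /andP[? ?] /andP[? ?] /andP[? ?].
by rewrite lerBlDr ler_norml; apply/andP; split; lra.
Qed.

(** The radius [d] is chosen before the dual pair, from continuity at [s] alone, so the functional
    may later be made to depend on [t]. *)
Lemma flow_differentiable Z s e : flow Z -> 0 <= s <= 1 -> 0 < e ->
  exists2 d, 0 < d & forall t, 0 <= t <= 1 -> `|t - s| <= d ->
    forall C xi xi', dual_pair C xi xi' ->
    `|xi (Z t) - xi (Z s) - (t - s) * xi' (Z s)| <= `|t - s| * (C * e).
Proof.
move=> [Zc Zd] hs e0; have e3 : 0 < e / 3 by rewrite divr_gt0.
have [d d0 hd] := Zc s (e / 3) hs e3.
exists d => // t ht ts C xi xi' hxi.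
have [_ [xil' C0 xiC] _] := hxi.
have near r : Num.min s t <= r -> r <= Num.max s t -> N (Z r - Z s) <= e / 3.
  move=> h1 h2; apply: hd.
    case/andP: hs => s0 s1; case/andP: ht => t0 t1; apply/andP; split.
      by apply: le_trans h1; rewrite le_min s0.
    by apply: le_trans h2 _; rewrite ge_max s1.
  apply: le_trans ts; move: h1 h2; have [st|st] := leP s t => h1 h2.
    by rewrite !ger0_norm ?subr_ge0// lerD2r.
  by rewrite !ler0_norm ?subr_le0 ?(ltW st)// lerN2 lerD2r.
case/andP: hs => s0 s1; case/andP: ht => t0 t1.
have Ce : C * (e / 3) <= C * e by apply: ler_wpM2l => //; lra.
have [st|/ltW st] := leP s t.
  rewrite [`|t - s|]ger0_norm ?subr_ge0//.
  apply: (le_trans (Zd _ _ _ hxi s t (e / 3) s0 st t1 _)).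
    move=> r /andP[sr rt]; apply: near; first by rewrite ge_min sr.
    by rewrite le_max rt orbT.
  by apply: ler_wpM2l; rewrite ?subr_ge0.
have Zts : N (Z t - Z s) <= e / 3.
  by apply: near; rewrite ?ge_min ?le_max lexx ?orbT.
(* [flow_derivative] is anchored at the earlier time, which is now [t]. The oscillation around [Z t]
   is at most 2 e / 3, and moving the slope from [t] back to [s] costs another e / 3. *)
have h1 := Zd _ _ _ hxi t s (2 * (e / 3)) t0 st s1.
have {}h1 : `|xi (Z s) - xi (Z t) - (s - t) * xi' (Z t)| <= (s - t) * (C * (2 * (e / 3))).
  apply: h1 => r /andP[tr rs]; apply: le_trans (snorm_dist hB (Z s) _ _) _.
  rewrite mulr_natl mulr2n (snormBC hB (Z s)); apply: lerD => //.
  by apply: near; rewrite ?ge_min ?le_max ?tr ?rs ?orbT.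
have h2 : `|(s - t) * xi' (Z t) - (s - t) * xi' (Z s)| <= (s - t) * (C * (e / 3)).
  rewrite -mulrBr -(lfunB xil') normrM ger0_norm ?subr_ge0//.
  apply: ler_wpM2l; first by rewrite subr_ge0.
  by apply: le_trans (xiC _) _; apply: ler_wpM2l.
rewrite [`|t - s|]ler0_norm ?subr_le0// opprB.
move: h1 h2; rewrite !ler_norml => /andP[? ?] /andP[? ?].
by apply/andP; split; lra.
Qed.

(** The discrete form of [flow_derivative]: each step adds exactly [h] times [xi'] at the new point,
    and the bound [e] on the oscillation allows that point to be replaced by [a m]. *)
Lemma bounded_increment (xi xi' : X -> R) C h a m e : dual_pair C xi xi' ->
  0 < h -> trajectory h a ->
  forall j, (forall i, (i <= j)%N -> N (a (m + i)%N - a m) <= e) ->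
  `|xi (a (m + j)%N) - xi (a m) - h * j%:R * xi' (a m)| <= h * j%:R * (C * e).
Proof.
move=> [[D [xil D0 xiD]] [xil' C0 xiC] hG] h0 ha; elim=> [|j IH] he.
  by rewrite addn0 subrr !(mulr0, mul0r) subrr normr0.
have {}IH := IH (fun i ij => he i (leqW ij)).
have e1 : xi (a (m + j.+1)%N) = xi (a (m + j)%N) + h * xi' (a (m + j.+1)%N).
  rewrite addnS -(hG _ _ (ha _)) -(lfunZ xil) scalerA divff ?gt_eqF// scale1r.
  by rewrite (lfunB xil) addrC subrK.
have h1 : `|h * xi' (a (m + j.+1)%N) - h * xi' (a m)| <= h * (C * e).
  rewrite -mulrBr -(lfunB xil') normrM (gtr0_norm h0) ler_pM2l//.
  by apply: le_trans (xiC _) _; apply: ler_wpM2l => //; exact: he.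
rewrite e1 -natr1; move: IH h1; rewrite !ler_norml => /andP[? ?] /andP[? ?].
by apply/andP; split; lra.
Qed.

(** * The implicit Euler scheme and its limit along dyadic steps *)

Section Euler.
Variable step : R -> X -> X.
Hypothesis hstep : forall h z, 0 < h -> h * b <= 2^-1 ->
  G (step h z) (h^-1 *: (step h z - z)).

Definition euler h z0 n := iter n (step h) z0.

Lemma euler_trajectory h z0 : 0 < h -> h * b <= 2^-1 ->
  trajectory h (euler h z0).
Proof. by move=> h0 hb n; exact: hstep. Qed.

Lemma euler_stable h z w n : 0 < h -> h * b <= 2^-1 -> h * n%:R <= 1 ->
  N (euler h z n - euler h w n) <= K * N (z - w).
Proof.
move=> h0 hb hn.
apply: (@trajectory_bound h (fun n => euler h z n - euler h w n)) => // k.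
have := relation_sub (euler_trajectory z h0 hb k) (euler_trajectory w h0 hb k).
by rewrite -scalerBr !opprD !opprK addrACA.
Qed.

Variable k0 : nat.
Hypothesis hk0 : 2^-1 ^+ k0 * b <= 2^-1.

(** The shift [k0] makes every step size admissible for the resolvent and for the stability
    bound. *)
Definition dyadic k : R := 2^-1 ^+ (k + k0).

Lemma dyadic_gt0 k : 0 < dyadic k.
Proof. by rewrite exprn_gt0// invr_gt0. Qed.

Lemma dyadicS k : dyadic k.+1 = dyadic k / 2.
Proof. by rewrite /dyadic addSn exprSr. Qed.

Lemma dyadic_le k : dyadic k * b <= 2^-1.
Proof.
elim: k => [//|k IH]; rewrite dyadicS.
by have := mulr_gt0 (dyadic_gt0 k) b0; lra.
Qed.

Lemma dyadic_le1 k : dyadic k <= 1.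
Proof. by rewrite exprn_ile1// ?invr_ge0// invf_le1// ler1n. Qed.

Lemma dyadic_small d : 0 < d -> exists k, dyadic k <= d.
Proof.
move=> d0.
have : (fun n => 2^-1 ^+ n : R) @ \oo --> (0 : R).
  apply: cvg_expr; rewrite ger0_norm ?invr_ge0// invf_lt1 ?ltr1n//.
move=> /cvgr0Pnorm_le /(_ _ d0)[n _ hn]; exists n.
have := hn (n + k0)%N (leq_addr _ _); exact/le_trans/ler_norm.
Qed.

Definition euler_interp k z0 t := euler (dyadic k) z0 (Num.truncn (t / dyadic k)).

Lemma truncn_mul_le h (t : R) : 0 < h -> 0 <= t ->
  h * (Num.truncn (t / h))%:R <= t < h * (Num.truncn (t / h)).+1%:R.
Proof.
move=> h0 t0; have /truncn_itv/andP[h1 h2] : 0 <= t / h by rewrite divr_ge0// ltW.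
by rewrite -ler_pdivlMl// -ltr_pdivrMl// [h^-1 * t]mulrC h1 h2.
Qed.

Lemma truncn_half h (t : R) : 0 < h -> 0 <= t -> let n := Num.truncn (t / h) in
  let m := Num.truncn (t / (h / 2)) in m = (2 * n)%N \/ m = (2 * n).+1.
Proof.
move=> h0 t0 n m; have /andP[h1 h2] := truncn_mul_le h0 t0.
have h20 : 0 < h / 2 by rewrite divr_gt0.
have e1 : t / (h / 2) = 2 * (t / h) by field; rewrite gt_eqF.
have {}h1 : n%:R <= t / h by rewrite ler_pdivlMr// mulrC.
have {}h2 : t / h < n.+1%:R by rewrite ltr_pdivrMr// mulrC.
rewrite /m e1; have [lt|ge] := ltP (t / h) (n%:R + 2^-1).
  left; apply: truncn_def; rewrite -natr1 natrM; lra.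
by right; apply: truncn_def; rewrite -!natr1 natrM; rewrite -natr1 in h2; lra.
Qed.

Section SmoothData.
Variables z0 z1 z2 : X.
Hypotheses (hz1 : G z0 z1) (hz2 : G z1 z2).

(** The first term compares the two grids at a common time; the second pays for the extra half step
    when the finer grid has already advanced once more. *)
Let C0 := K ^+ 2 * N z2 + K * N z1.

Lemma euler_C0_ge0 : 0 <= C0.
Proof. by rewrite addr_ge0// mulr_ge0// ?sqr_ge0// expR_ge0. Qed.

Lemma euler_increment h n : 0 < h -> h * b <= 2^-1 -> h * n.+1%:R <= 1 ->
  N (euler h z0 n.+1 - euler h z0 n) <= h * (K * N z1).
Proof.
move=> h0 hb hn; have te := euler_trajectory z0 h0 hb.
rewrite (trajectory_slopeE _ z1 _ h0) (snormZ hB) gtr0_norm// ler_pM2l//.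
have tt := trajectory_slope_trajectory (z1 := z1) te hz1.
exact: (trajectory_bound h0 hb tt (n := n.+1)).
Qed.

Lemma euler_interp_refine k t : 0 <= t <= 1 ->
  N (euler_interp k.+1 z0 t - euler_interp k z0 t) <= C0 * dyadic k.
Proof.
move=> /andP[t0 t1]; rewrite /euler_interp dyadicS; set h := dyadic k.
have h0 : 0 < h by exact: dyadic_gt0.
have h20 : 0 < h / 2 by rewrite divr_gt0.
have hb : h * b <= 2^-1 by exact: dyadic_le.
have hb2 : h / 2 * b <= 2^-1 by have := mulr_gt0 h0 b0; lra.
set n := Num.truncn (t / h); set m := Num.truncn (t / (h / 2)).
have /andP[hn _] := truncn_mul_le h0 t0.
have /andP[hm _] := truncn_mul_le h20 t0.
have h1 : N (euler (h / 2) z0 (2 * n)%N - euler h z0 n) <= K ^+ 2 * N z2 * h.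
  apply: (trajectory_refine (z1 := z1)) => //; try exact: euler_trajectory.
  exact: le_trans t1.
have Kz : 0 <= K * N z1 by rewrite mulr_ge0// expR_ge0.
have hmn := truncn_half h0 t0; rewrite -/n -/m in hmn hm.
case: hmn => [->|mE].
  apply: (le_trans h1); rewrite ler_wpM2r ?(ltW h0)//.
  by rewrite lerDl.
have := @euler_increment (h / 2) (2 * n) h20 hb2; rewrite -mE.
move=> /(_ (le_trans hm t1)) h2.
apply: le_trans (snorm_dist hB (euler (h / 2) z0 (2 * n)) _ _) _.
rewrite /C0; have := mulr_ge0 (ltW h0) Kz; lra.
Qed.

Hypothesis complB : rate_complete B.

Lemma euler_limit : exists Z, forall k t, 0 <= t <= 1 ->
  N (euler_interp k z0 t - Z t) <= 2 * C0 * dyadic k.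
Proof.
have C00 : 0 <= 2 * C0 by rewrite mulr_ge0// euler_C0_ge0.
have /choice[Z hZ] : forall t, exists l, 0 <= t <= 1 ->
    forall k, N (euler_interp k z0 t - l) <= 2 * C0 * dyadic k.
  move=> t; have [ht|] := boolP (0 <= t <= 1); last by exists 0.
  (* The factor 2 is the sum of the geometric series of ratio 1/2. Below, [2 * C0 + 1] is used as a
     divisor because [C0] may vanish. *)
  have [||l hl] := @complB (fun k => euler_interp k z0 t) (fun k => 2 * C0 * dyadic k).
  - move=> d d0; have d1 : 0 < d / (2 * C0 + 1) by rewrite divr_gt0// ltr_wpDl.
    have [k hk] := dyadic_small d1; exists k.
    apply: le_trans (_ : (2 * C0 + 1) * dyadic k <= d).
      by have := dyadic_gt0 k; lra.
    by rewrite mulrC -ler_pdivlMr// ltr_wpDl.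
  - apply: (geometric_cauchy hB (r := 2^-1)) => // k; last first.
      by rewrite mulr_ge0// ltW// dyadic_gt0.
      by rewrite dyadicS; field.
    by have := euler_interp_refine k ht; lra.
  by exists l.
by exists Z => k t ht; exact: hZ.
Qed.

(** The interpolant is piecewise constant, so two arbitrarily close times may be separated by a
    jump; this accounts for the additional [dyadic k]. *)
Lemma euler_interp_lipschitz k s t : 0 <= s <= 1 -> 0 <= t <= 1 ->
  N (euler_interp k z0 t - euler_interp k z0 s) <= (`|t - s| + dyadic k) * (K * N z1).
Proof.
wlog st : s t / s <= t => [hw hs ht|].
  have [st|/ltW ts] := leP s t; first exact: hw.
  by rewrite (snormBC hB) distrC; exact: hw.
move=> /andP[s0 s1] /andP[t0 t1]; rewrite /euler_interp; set h := dyadic k.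
have h0 : 0 < h by exact: dyadic_gt0.
have hb : h * b <= 2^-1 by exact: dyadic_le.
have /andP[n1 n2] := truncn_mul_le h0 t0.
have /andP[m1 m2] := truncn_mul_le h0 s0.
set n := Num.truncn (t / h) in n1 n2 *; set m := Num.truncn (s / h) in m1 m2 *.
have mn : (m <= n)%N.
  rewrite -ltnS -(ltr_nat R) -(ltr_pM2l h0); apply: le_lt_trans n2.
  exact: le_trans m1 st.
have Kz : 0 <= K * N z1 by rewrite mulr_ge0// expR_ge0.
apply: le_trans (_ : h * (n - m)%:R * (K * N z1) <= _); last first.
  apply: ler_wpM2r => //; rewrite natrB// ger0_norm ?subr_ge0//.
  by rewrite -natr1 in m2; lra.
have h1 j : h * (m + j)%:R <= 1 ->
    N (euler h z0 (m + j) - euler h z0 m) <= h * j%:R * (K * N z1).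
  elim: j => [|j IH] hj; first by rewrite addn0 subrr (snorm0 hB) mulr0 mul0r.
  have hj' : h * (m + j)%:R <= 1.
    by apply: le_trans hj; rewrite ler_pM2l// ler_nat leq_add2l.
  apply: le_trans (snorm_dist hB (euler h z0 (m + j)) _ _) _.
  rewrite addnS in hj *; have := euler_increment h0 hb hj; have := IH hj'.
  by rewrite -natr1; lra.
by have := h1 (n - m)%N; rewrite subnKC// => -> //; exact: le_trans t1.
Qed.

Lemma euler_flow Z :
  (forall k t, 0 <= t <= 1 -> N (euler_interp k z0 t - Z t) <= 2 * C0 * dyadic k) ->
  flow Z.
Proof.
move=> hZ; have Kz : 0 <= K * N z1 by rewrite mulr_ge0// expR_ge0.
have C00 := euler_C0_ge0.
split=> [s e hs e0|C xi xi' hxi s t e s0 st t1 he].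
  have M0 : 0 < K * N z1 + 1 by rewrite ltr_wpDl.
  exists (e / (K * N z1 + 1)); first by rewrite divr_gt0.
  move=> t ht; rewrite ler_pdivlMr// => td; rewrite -subr_le0.
  apply: (@le0_of_small _ _ (4 * C0 + K * N z1)) => d /dyadic_small[k hk].
  have h1 : N (Z t - Z s) <= 4 * C0 * dyadic k + (`|t - s| + dyadic k) * (K * N z1).
    apply: le_trans (snorm_dist hB (euler_interp k z0 t) _ _) _.
    apply: le_trans (lerD (lexx _) (snorm_dist hB (euler_interp k z0 s) _ _)) _.
    have := hZ k t ht; have := hZ k s hs; have := euler_interp_lipschitz k hs ht.
    by rewrite (snormBC hB (Z t)); lra.
  have h2 : dyadic k * (4 * C0 + K * N z1) <= d * (4 * C0 + K * N z1).
    by apply: ler_wpM2r => //; lra.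
  have := normr_ge0 (t - s); lra.
have hxi2 := hxi; have [[D [xil D0 xiD]] [xil' C_ge0 xiC] _] := hxi2.
have hs : 0 <= s <= 1 by rewrite s0 (le_trans st).
have ht : 0 <= t <= 1 by rewrite t1 andbT (le_trans s0).
have t0 : 0 <= t by case/andP: ht.
have ts : 0 <= t - s by rewrite subr_ge0.
(* In order: the two values of [xi] at the ends; the errors from the enlarged oscillation [E] and
   the enlarged time span (three terms, [f5]); the time rounding in the slope term ([f3]); and the
   error of the slope at the base point ([f4]). *)
rewrite -subr_le0; apply: (@le0_of_small _ _ (4 * D * C0 + C * (4 * C0) + C * e +
  (t - s) * (C * (4 * C0)) + C * (N (Z s) + 2 * C0) + (t - s) * (C * (2 * C0)))).
move=> d /dyadic_small[k hk].
pose h := dyadic k; have h0 : 0 < h by exact: dyadic_gt0.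
have hb : h * b <= 2^-1 by exact: dyadic_le.
have h1 : h <= 1 by exact: dyadic_le1.
have /andP[n1 n2] := truncn_mul_le h0 t0.
have /andP[m1 m2] := truncn_mul_le h0 s0.
have := hZ k t ht; have := hZ k s hs; rewrite /euler_interp -/h.
set n := Num.truncn (t / h) in n1 n2 *; set m := Num.truncn (s / h) in m1 m2 *.
move=> Zs Zt.
have mn : (m <= n)%N.
  rewrite -ltnS -(ltr_nat R) -(ltr_pM2l h0); apply: le_lt_trans n2.
  exact: le_trans m1 st.
have e_ge0 : 0 <= e.
  by have := he s; rewrite lexx st subrr (snorm0 hB); exact.
pose E := 4 * C0 * h + e.
have hE i : (i <= n - m)%N -> N (euler h z0 (m + i)%N - euler h z0 m) <= E.
  (* The index 0 is separate: the grid time [h * m%:R] may precede [s], whereas all later grid times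
     up to [n] lie in [s, t], where the hypothesis [he] applies. *)
  case: i => [|i] hi.
    by rewrite addn0 subrr (snorm0 hB) addr_ge0// !mulr_ge0// ltW.
  pose r := h * (m + i.+1)%:R.
  have rs : s <= r.
    by apply: (le_trans (ltW m2)); rewrite /r ler_pM2l// ler_nat addnS ltnS leq_addr.
  have rt : r <= t.
    by apply: le_trans n1; rewrite /r ler_pM2l// ler_nat -leq_subRL.
  have hr : 0 <= r <= 1 by rewrite (le_trans s0 rs) (le_trans rt t1).
  have := hZ k r hr; rewrite /euler_interp -/h.
  have -> : Num.truncn (r / h) = (m + i.+1)%N.
    by rewrite /r mulrC mulKf ?gt_eqF// natrK.
  move=> Zr; apply: le_trans (snorm_dist hB (Z r) _ _) _.
  apply: le_trans (lerD (lexx _) (snorm_dist hB (Z s) _ _)) _.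
  have := he r; rewrite rs rt => /(_ isT); move: Zr Zs; rewrite /E -/h.
  by rewrite (snormBC hB (Z s)); lra.
have := bounded_increment (m := m) hxi h0 (euler_trajectory z0 h0 hb) hE.
rewrite subnKC//; set a := euler h z0 n in Zt *; set c := euler h z0 m in Zs *.
set q := h * (n - m)%:R => incr.
have qts : `|q - (t - s)| <= h.
  rewrite /q natrB// ler_norml; rewrite -natr1 in m2; rewrite -natr1 in n2.
  by apply/andP; split; lra.
have q0 : 0 <= q by rewrite mulr_ge0// ltW.
have f1 : `|xi a - xi (Z t)| <= D * (2 * C0 * h).
  by rewrite -(lfunB xil); apply: le_trans (xiD _) _; apply: ler_wpM2l.
have f2 : `|xi c - xi (Z s)| <= D * (2 * C0 * h).
  by rewrite -(lfunB xil); apply: le_trans (xiD _) _; apply: ler_wpM2l.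
have Nc : N c <= N (Z s) + 2 * C0 * h.
  by apply: le_trans (snorm_le_dist hB _ (Z s)) _; rewrite lerD2l.
have f3 : `|q * xi' c - (t - s) * xi' c| <= h * (C * (N (Z s) + 2 * C0 * h)).
  rewrite -mulrBl normrM; apply: ler_pM => //.
  by apply: le_trans (xiC _) _; apply: ler_wpM2l.
have f4 : `|(t - s) * xi' c - (t - s) * xi' (Z s)| <= (t - s) * (C * (2 * C0 * h)).
  rewrite -mulrBr normrM (ger0_norm ts); apply: ler_wpM2l => //.
  by rewrite -(lfunB xil'); apply: le_trans (xiC _) _; apply: ler_wpM2l.
have f5 : q * (C * E) <= (t - s + h) * (C * (4 * C0 * h + e)).
  apply: ler_wpM2r.
    by rewrite mulr_ge0// addr_ge0// mulr_ge0 ?(ltW h0)// mulr_ge0.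
  by move: qts; rewrite ler_norml => /andP[? ?]; lra.
have {}incr := le_trans incr f5.
have hh : h * (C * C0 * h) <= h * (C * C0).
  by rewrite ler_pM2l// ler_piMr// mulr_ge0.
set M := (X in d * X).
have M0 : 0 <= M by rewrite /M !addr_ge0// !mulr_ge0// addr_ge0// mulr_ge0.
apply: le_trans (_ : h * M <= _); last exact: ler_wpM2r.
rewrite lerBlDr ler_norml /M.
move: incr f1 f2 f3 f4; rewrite !ler_norml.
move=> /andP[? ?] /andP[? ?] /andP[? ?] /andP[? ?] /andP[? ?].
by apply/andP; split; lra.
Qed.

End SmoothData.

Lemma flow_exists_aux (complB : rate_complete B) z0 :
  (forall d, 0 < d -> exists w w', G w w' /\ N (w - z0) <= d) ->
  exists2 Z, flow Z & N (Z 0 - z0) = 0.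
Proof.
move=> hz0.
have h0 := dyadic_gt0 0; have hb := dyadic_le 0.
have hz2 d : 0 < d -> exists w w1 w2, [/\ G w w1, G w1 w2 & N (w - z0) <= d].
  move=> d0; have [w [w' [Gw wz0]]] := hz0 _ (divr_gt0 d0 (ltr0n R 2)).
  (* One Euler step moves [w] by at most [2 * h * N w'], because 1 - h b >= 1/2; a step size below
     [d] divided by this constant keeps the displacement under [d / 2]. *)
  have M0 : 0 < 4 * K * N w' + 1 by rewrite ltr_wpDl// !mulr_ge0// expR_ge0.
  have [k hk] := dyadic_small (divr_gt0 d0 M0).
  have hk0' := dyadic_gt0 k; have hkb := dyadic_le k.
  set h := dyadic k in hk hk0' hkb.
  pose y := step h w; have Gy : G y (h^-1 *: (y - w)) by exact: hstep.
  (* The first image is itself a multiple of a difference of two points related by [G], so linearity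
     provides its image: one resolvent step gains one power of [G]. *)
  exists y, (h^-1 *: (y - w)), (h^-1 *: (h^-1 *: (y - w) - w')).
  split=> //; first exact: relation_scale (relation_sub Gy Gw).
  apply: le_trans (snorm_dist hB w _ _) _.
  suff : N (y - w) <= d / 2 by lra.
  have e1 : y - w = h *: (h^-1 *: (y - w)).
    by rewrite scalerA divff ?scale1r// gt_eqF.
  have := step_bound (e0 := 0) (r := h *: w') hk0' (relation_sub Gy Gw).
  rewrite subr0 scalerBr -e1 subrK => /(_ erefl).
  rewrite (snorm0 hB) add0r (snormZ hB) gtr0_norm//.
  move: hk; rewrite ler_pdivlMr// => hk.
  have K1 : 1 <= K by rewrite -expR0 ler_expR; have := b0; lra.
  have : N w' * h <= K * (N w' * h) by rewrite ler_peMl// mulr_ge0// ltW.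
  have : 2^-1 * N (y - w) <= (1 - h * b) * N (y - w) by rewrite ler_wpM2r//; lra.
  lra.
pose dl (n : nat) : R := n.+1%:R^-1.
have dl0 n : 0 < dl n by rewrite invr_gt0.
have dlmono n k : (n <= k)%N -> dl k <= dl n.
  by move=> nk; rewrite lef_pV2 ?posrE// ler_nat.
have K0 : 0 < K by exact: expR_gt0.
have dlsmall d : 0 < d -> exists n, 2 * K * dl n <= d.
  move=> d0; exists (Num.truncn (2 * K / d)); rewrite /dl ler_pdivrMr//.
  by rewrite [d * _]mulrC -ler_pdivrMr// ltW// truncnS_gt.
have /choice[w hw] := fun n => hz2 _ (dl0 n).
have /choice[Y hY] : forall n, exists Y, exists C, [/\ 0 <= C, flow Y
    & forall k t, 0 <= t <= 1 -> N (euler_interp k (w n) t - Y t) <= C * dyadic k].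
  move=> n; have [w1 [w2 [Gw Gw1 _]]] := hw n.
  have [Y hY] := euler_limit Gw Gw1 complB.
  exists Y, (2 * (K ^+ 2 * N w2 + K * N w1)); split=> //; last exact: euler_flow hY.
  by rewrite mulr_ge0// euler_C0_ge0.
have wz n : N (w n - z0) <= dl n by have [? [? []]] := hw n.
(* The constants [C] of the limits [Y n] depend on the images of [w n], with no bound uniform in
   [n]. Hence the comparison is made between Euler iterates of the same step, where stability costs
   only [K], and the step is refined afterwards. *)
have YY n m t : 0 <= t <= 1 -> N (Y m t - Y n t) <= K * N (w m - w n).
  move=> ht; have [C [C_ge0 _ hC]] := hY n; have [D [D0 _ hD]] := hY m.
  rewrite -subr_le0; apply: (@le0_of_small _ _ (C + D)) => d /dyadic_small[k hk].
  have := hC k t ht; have := hD k t ht.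
  have : N (euler_interp k (w m) t - euler_interp k (w n) t) <= K * N (w m - w n).
    apply: euler_stable; [exact: dyadic_gt0|exact: dyadic_le|].
    case/andP: ht => t0 t1; have /andP[h1 _] := truncn_mul_le (dyadic_gt0 k) t0.
    exact: le_trans t1.
  set a := euler_interp _ _ _; set c := euler_interp _ _ _ => h1 h2 h3.
  have := ler_wpM2r (addr_ge0 C_ge0 D0) hk.
  have : N (Y m t - Y n t) <= N (Y m t - a) + (N (a - c) + N (c - Y n t)).
    apply: le_trans (snorm_dist hB a _ _) _; rewrite lerD2l.
    exact: snorm_dist.
  by rewrite (snormBC hB (Y m t) a); lra.
have /choice[Z hZ] : forall t, exists l, 0 <= t <= 1 ->
    forall n, N (Y n t - l) <= 2 * K * dl n.
  move=> t; have [ht|] := boolP (0 <= t <= 1); last by exists 0.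
  have [|l hl] := @complB (fun n => Y n t) (fun n => 2 * K * dl n) dlsmall.
    move=> n m nm; apply: le_trans (YY n m t ht) _.
    rewrite [2 * K]mulrC -mulrA ler_pM2l//.
    apply: le_trans (snorm_dist hB z0 _ _) _; rewrite (snormBC hB z0).
    by have := wz n; have := wz m; have := dlmono _ _ nm; lra.
  by exists l.
exists Z.
  apply: flow_limit => d /dlsmall[n hn]; exists (Y n); first by have [? []] := hY n.
  by move=> t ht; apply: le_trans hn; exact: hZ.
apply/eqP; rewrite eq_le N_ge0 andbT.
have h01 : is_true ((0 : R) <= (0 : R) <= (1 : R)) by rewrite lexx ler01.
have Yw n : N (Y n 0 - w n) <= 0.
  have [C [C_ge0 _ hC]] := hY n.
  apply: (@le0_of_small _ _ C) => d /dyadic_small[k hk].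
  (* At time 0 every interpolant equals its initial value [w n], so [Y n 0] is at distance zero from
     [w n]. *)
  have := hC k 0 h01; rewrite /euler_interp mul0r truncn0 /euler /=.
  rewrite (snormBC hB); move=> /le_trans; apply; rewrite mulrC.
  exact: ler_wpM2r.
apply: (@le0_of_small _ _ 2) => d d0; have [n hn] := dlsmall d d0.
have K1 : 1 <= K by rewrite -expR0 ler_expR; have := b0; lra.
have h1 : N (Z 0 - z0) <= N (Z 0 - Y n 0) + (N (Y n 0 - w n) + N (w n - z0)).
  by apply: le_trans (snorm_dist hB (Y n 0) _ _) _; rewrite lerD2l snorm_dist.
have := hZ 0 h01 n; have := Yw n; have := wz n.
have : dl n <= K * dl n by rewrite ler_peMl// ltW.
by move: h1; rewrite (snormBC hB (Z 0) (Y n 0)); lra.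
Qed.

End Euler.

Theorem flow_exists (complB : rate_complete B) z0 :
  (forall d, 0 < d -> exists w w', G w w' /\ N (w - z0) <= d) ->
  exists2 Z, flow Z & N (Z 0 - z0) = 0.
Proof.
move=> hz0.
(* A resolvent as a total function of step size and vector; its value is arbitrary for inadmissible
   steps. *)
have /choice[f hf] : forall p : R * X, exists z, 0 < p.1 -> p.1 * b <= 2^-1 ->
    G z (p.1^-1 *: (z - p.2)).
  move=> [h z] /=; have [h0|] := boolP (0 < h); last by exists 0.
  have [hb|] := boolP (h * b <= 2^-1); last by exists 0.
  by have [y hy] := G_range h0 hb z; exists y.
have [k hk] : exists k, 2^-1 ^+ k * b <= 2^-1.
  have d0 : 0 < 2^-1 / b by rewrite divr_gt0// invr_gt0.
  have : (fun n => 2^-1 ^+ n : R) @ \oo --> (0 : R).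
    by apply: cvg_expr; rewrite ger0_norm ?invr_ge0// invf_lt1// ltr1n.
  move=> /cvgr0Pnorm_le /(_ _ d0)[n _ /(_ n (leqnn n))] hn; exists n.
  by rewrite -ler_pdivlMr//; apply: le_trans (ler_norm _) hn.
apply: (@flow_exists_aux (fun h z => f (h, z)) _ k hk complB z0 hz0).
by move=> h z h0 hb; exact: (hf (h, z)).
Qed.

End QuasiDissipative.

(** * The space L^2(0,1) *)

Section SquareIntegrable.
Variable R : realType.
Local Notation mu := (@lebesgue_measure R).
Local Notation D := (`]0, 1[%classic : set R).
Implicit Types f g : R -> R.

Lemma ae_imply (P Q : R -> Prop) : (forall y, P y -> Q y) ->
  {ae mu, forall y, P y} -> {ae mu, forall y, Q y}.
Proof.
move=> PQ; apply: (@filterS _ _ (ae_filter_ringOfSetsType mu)); exact: PQ.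
Qed.

Lemma patchM01 f g : (f \* g) \_ D = (f \_ D) \* (g \_ D).
Proof.
by apply/funext => y; rewrite /= !patchE; case: ifP => //; rewrite mulr0.
Qed.

Lemma in_L2_measurable f : in_L2 f -> measurable_fun D f.
Proof.
rewrite /in_L2 inE => /andP[/[!inE]/= mf _].
exact: (measurable_restrictT f (measurable_itv _)).2 mf.
Qed.

Lemma in_L2_integrableM f g : in_L2 f -> in_L2 g ->
  mu.-integrable D (EFin \o (f \* g)).
Proof.
move=> hf hg; have /Lfun1_integrable := Lfun2_mul_Lfun1 hf hg.
rewrite -patchM01 => h; apply/integrable_mkcond => //.
by rewrite restrict_EFin.
Qed.

Lemma in_L2P f : in_L2 f <->
  measurable_fun D f /\ mu.-integrable D (EFin \o (f \* f)).
Proof.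
split=> [hf|[mf ff]].
  by split; [exact: in_L2_measurable|exact: in_L2_integrableM].
have mf' : measurable_fun setT (f \_ D) by apply: (measurable_restrictT f _).1.
rewrite /in_L2 inE; apply/andP; split; rewrite inE/=; first exact: mf'.
rewrite /finite_norm unlock /= poweR_lty//.
have : mu.-integrable setT ((EFin \o (f \* f)) \_ D) by apply: (integrable_mkcond _ _).1.
move=> /integrableP[_].
apply: le_lt_trans; rewrite le_eqVlt; apply/orP; left; apply/eqP.
apply: eq_integral => y _ /=.
rewrite powR_mulrn// restrict_EFin /= patchM01 /=.
by rewrite -expr2 normrX.
Qed.

Lemma in_L2_submod_closed (a : R) f g : in_L2 f -> in_L2 g -> in_L2 (a *: f + g).
Proof.
move=> hf hg; rewrite /in_L2.
have -> : (a *: f + g) \_ D = a *: (f \_ D) + (g \_ D) :> (R -> R).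
  apply/funext => y; rewrite /= !fctE !patchE; case: ifP => //.
  by rewrite scaler0 addr0.
have [_ h] := @Lfun_submod_closed _ _ _ mu 2%:E (lee1n 2).
exact: (h a _ _ hf hg).
Qed.

Lemma in_L20 : in_L2 (0 : R -> R).
Proof.
have [h _] := @Lfun_submod_closed _ (measurableTypeR R) _ mu 2%:E (lee1n 2).
rewrite /in_L2 (_ : _ \_ _ = 0)//.
by apply/funext => y; rewrite patchE; case: ifP.
Qed.

Definition L2pred : {pred R -> R} := fun f => `[< in_L2 f >].

Fact L2pred_closed : submod_closed L2pred.
Proof.
split=> [|a f g]; first exact/asboolP/in_L20.
by move=> /asboolP hf /asboolP hg; exact/asboolP/in_L2_submod_closed.
Qed.

HB.instance Definition _ :=
  GRing.isSubmodClosed.Build R (R -> R) L2pred L2pred_closed.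

Record L2 := MkL2 { L2_val :> R -> R; L2_valP : L2_val \in L2pred }.
HB.instance Definition _ := [isSub for L2_val].
HB.instance Definition _ := [Choice of L2 by <:].
HB.instance Definition _ := [SubChoice_isSubLmodule of L2 by <:].

Definition toL2 f (hf : in_L2 f) : L2 := @MkL2 f (asboolT hf).

Lemma L2P (f : L2) : in_L2 f.
Proof. by case: f => f /= /asboolP. Qed.

Lemma L2inner_linl (a : R) f g h : in_L2 f -> in_L2 g -> in_L2 h ->
  L2inner (a *: f + g) h = a * L2inner f h + L2inner g h.
Proof.
move=> hf hg hh; rewrite /L2inner -RintegralZl//; last exact: in_L2_integrableM.
rewrite -RintegralD//.
- by apply: eq_Rintegral => y _; rewrite !fctE mulrDl -mulrA.
- by apply: eq_integrable (integrableZl _ a (in_L2_integrableM hf hh)).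
- exact: in_L2_integrableM.
Qed.

Lemma L2innerC f g : L2inner f g = L2inner g f.
Proof. by apply: eq_Rintegral => y _; rewrite mulrC. Qed.

Lemma L2_semi_inner : semi_inner_product (fun f g : L2 => L2inner f g).
Proof.
split=> [a f g h|f g|f].
- by rewrite -L2inner_linl//; exact: L2P.
- exact: L2innerC.
- by apply: Rintegral_ge0 => y _; rewrite -expr2 sqr_ge0.
Qed.

Lemma L2normE f : in_L2 f -> L2norm f = Num.sqrt (L2inner f f).
Proof.
move=> hf; rewrite /L2norm unlock /=.
have -> : (\int[mu]_x (`|(f \_ D) x| `^ 2)%:E = (L2inner f f)%:E)%E.
  rewrite /L2inner /Rintegral fineK; last first.
    by apply: integrable_fin_num => //; exact: in_L2_integrableM.
  rewrite [RHS]integral_mkcond; apply: eq_integral => y _.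
  rewrite restrict_EFin/= powR_mulrn// -normrX ger0_norm ?sqr_ge0//.
  by rewrite expr2 -[in LHS]/(((f \_ D) \* (f \_ D)) y) -patchM01.
by rewrite poweR_EFin/= powR12_sqrt// (let: And3 _ _ h := L2_semi_inner in h (toL2 hf)).
Qed.

Lemma L2innerE f g : in_L2 f -> in_L2 g ->
  ((L2inner f g)%:E = \int[mu]_(y in D) (f y * g y)%:E)%E.
Proof.
move=> hf hg; rewrite /L2inner /Rintegral fineK//.
by apply: integrable_fin_num => //; exact: in_L2_integrableM.
Qed.

Lemma L2norm_seminorm (f : L2) : seminorm (fun f g : L2 => L2inner f g) f = L2norm f.
Proof. by rewrite L2normE//; exact: L2P. Qed.

Lemma L2norm_ge0 f : 0 <= L2norm f.
Proof. by rewrite fine_ge0// Lnorm_ge0. Qed.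

Lemma sqr_L2norm f : in_L2 f -> L2norm f ^+ 2 = L2inner f f.
Proof.
move=> hf; rewrite L2normE// sqr_sqrtr//.
by have [_ _ /(_ (toL2 hf))] := L2_semi_inner.
Qed.

Lemma L2_CS f g : in_L2 f -> in_L2 g -> `|L2inner f g| <= L2norm f * L2norm g.
Proof.
by move=> hf hg; have := ip_CS L2_semi_inner (toL2 hf) (toL2 hg);
  rewrite !L2norm_seminorm.
Qed.

Lemma in_L2_bounded f (M : R) : measurable_fun D f ->
  (forall y, D y -> `|f y| <= M) -> in_L2 f.
Proof.
move=> mf fM; apply/in_L2P; split => //.
apply: measurable_bounded_integrable => //.
- by rewrite /= lebesgue_measure_itv /= lte_fin ltr01 oppr0 adde0 ltry.
- exact: measurable_funM.
exists (M * M); split; first exact: num_real.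
move=> x Mx y Dy; apply: le_trans (ltW Mx).
by rewrite normrM ler_pM// fM.
Qed.

Lemma in_L2_cst (c : R) : in_L2 (cst c).
Proof. by apply: (@in_L2_bounded _ `|c|) => // y _. Qed.

Lemma in_L2_norm f : in_L2 f -> in_L2 (fun y => `|f y|).
Proof.
move=> /in_L2P[mf ff]; apply/in_L2P; split; first exact: measurableT_comp.
apply: eq_integrable ff => // y _ /=.
by rewrite -normrM ger0_norm// -expr2 sqr_ge0.
Qed.

Lemma integral_norm_le_L2norm f : in_L2 f ->
  (\int[mu]_(y in D) `|f y|%:E <= (L2norm f)%:E)%E.
Proof.
move=> hf; have hf' := in_L2_norm hf; have h1 := in_L2_cst 1.
have := L2_CS hf' h1.
have -> : L2norm (fun y => `|f y|) = L2norm f.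
  rewrite !L2normE//; congr Num.sqrt; apply: eq_Rintegral => y _ /=.
  by rewrite -normrM ger0_norm// -expr2 sqr_ge0.
have -> : L2norm (cst 1 : R -> R) = 1.
  rewrite L2normE// /L2inner; under eq_Rintegral do rewrite mulr1.
  rewrite Rintegral_cst// mul1r /= lebesgue_measure_itv /= lte_fin ltr01.
  by rewrite oppr0 adde0 sqrtr1.
rewrite mulr1 -lee_fin => h; apply: le_trans h.
apply: le_trans (_ : (L2inner (fun y => `|f y|) (cst 1))%:E <= _)%E; last first.
  by rewrite lee_fin ler_norm.
by rewrite L2innerE//; under [leRHS]eq_integral do rewrite /= mulr1.
Qed.

End SquareIntegrable.

(** * Completeness of L^2(0,1) *)

Section RieszFischer.
Variable R : realType.
Local Notation mu := (@lebesgue_measure R).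
Local Notation D := (`]0, 1[%classic : set R).

(** The L^2 norm dominates the L^1 norm on the unit interval, so by monotone convergence the sum of
    the absolute increments is integrable, hence finite almost everywhere, and there the telescoping
    series converges. *)
Lemma ae_cvg_of_summable (g : nat -> R -> R) :
  (forall n, in_L2 (g n)) ->
  (forall n, L2norm (g n.+1 \- g n) <= 2 / (2 ^ (n + 1))%:R) ->
  exists2 l : R -> R, measurable_fun D l &
    {ae mu, forall y, D y -> (fun n => g n y) @ \oo --> l y}.
Proof.
move=> hg dg; have mg n := in_L2_measurable (hg n).
pose S y := (\sum_(n <oo) `|g n.+1 y - g n y|%:E)%E.
have mt n : measurable_fun D (fun y => `|g n.+1 y - g n y|%:E).
  by apply/measurable_EFinP; apply: measurableT_comp => //; exact: measurable_funB.
have mS : measurable_fun D S.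
  by apply: ge0_emeasurable_sum => // n y _ _; rewrite lee_fin.
have hd n : in_L2 (g n.+1 \- g n).
  have := in_L2_submod_closed (-1) (hg n) (hg n.+1).
  by rewrite scaleN1r addrC.
have iS : mu.-integrable D S.
  apply/integrableP; split => //.
  under eq_integral => y _.
    rewrite gee0_abs; last by apply: nneseries_ge0 => n _ _; rewrite lee_fin.
    over.
  rewrite integral_nneseries//.
  apply: le_lt_trans (_ : \sum_(n <oo) (2 / (2 ^ (n + 1))%:R)%:E < +oo)%E.
    apply: lee_nneseries => [n _ _|n _]; first exact: integral_ge0.
    by apply: le_trans (integral_norm_le_L2norm (hd n)) _; rewrite lee_fin dg.
  have := @cvg_geometric_eseries_half R 2 0.
  by move=> /cvg_lim; rewrite /eseries => -> //; exact: ltry.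
(* After restriction to [E] the sequence converges at every point of the interval, which gives
   measurability of the limit. *)
pose E := D `&` [set y | S y \is a fin_num].
have mE : measurable E by exact: emeasurable_fin_num.
pose l y := limn (fun n => (g n \_ E) y).
have cE y : E y -> cvgn (fun n => g n y).
  move=> [Dy Sy].
  have : cvgn (series (fun n => g n.+1 y - g n y)).
    apply: normed_cvg; rewrite (_ : [normed series _] =
      (fun n => \sum_(0 <= k < n) `|g k.+1 y - g k y|))//.
    apply: nondecreasing_is_cvgn.
      by apply/nondecreasing_seqP => n; rewrite big_nat_recr//= lerDl.
    exists (fine (S y)) => _ [n _ <-] /=.
    rewrite -lee_fin fineK// -sumEFin.
    by apply: nneseries_lim_ge => k _ _; rewrite lee_fin.
  rewrite (_ : series _ = (fun n => g n y - g 0%N y)); last first.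
    by apply/funext => n; rewrite /series/= (telescope_sumr (fun k => g k y)).
  move=> /cvg_ex[c hc]; apply/cvg_ex; exists (c + g 0%N y).
  rewrite (_ : (fun n => g n y) = (fun n => g n y - g 0%N y + g 0%N y)); last first.
    by apply/funext => n; rewrite subrK.
  by apply: cvgD => //; exact: cvg_cst.
exists l.
  apply: (@measurable_fun_cvg _ _ _ D (fun n => g n \_ E)) => [n|y Dy].
    apply/(measurable_restrict _ _ _).1 => //.
    by apply: measurable_funS (mg n) => // y [].
  have [Ey|nEy] := pselect (E y).
    rewrite /l (_ : (fun n => (g n \_ E) y) = (fun n => g n y)); last first.
      by apply/funext => n; rewrite patchE mem_set.
    exact: cE.
  rewrite /l (_ : (fun n => (g n \_ E) y) = cst 0); last first.
    by apply/funext => n; rewrite patchE memNset.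
  by rewrite lim_cst//; exact: cvg_cst.
have : {ae mu, forall y, D y -> S y \is a fin_num} by apply: integrable_ae iS.
apply: ae_imply => y Sy Dy; have Ey : E y by split=> //; exact: Sy.
rewrite /l (_ : (fun n => (g n \_ E) y) = (fun n => g n y)); last first.
  by apply/funext => n; rewrite patchE mem_set.
exact: cE.
Qed.

(** Fatou applied to the squares of x - g n. It yields at once that the almost everywhere limit lies
    in L^2 and that bounds on distances pass to it. *)
Lemma fatou_L2 (x l : R -> R) (g : nat -> R -> R) (c : R) :
  in_L2 x -> (forall n, in_L2 (g n)) -> measurable_fun D l -> 0 <= c ->
  {ae mu, forall y, D y -> (fun n => g n y) @ \oo --> l y} ->
  (\forall n \near \oo, L2norm (x \- g n) <= c) ->
  in_L2 (x \- l) /\ L2norm (x \- l) <= c.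
Proof.
move=> hx hg ml c0 gl hc.
have mx := in_L2_measurable hx; have mg n := in_L2_measurable (hg n).
have hxg n : in_L2 (x \- g n).
  have := in_L2_submod_closed (-1) (hg n) hx.
  by rewrite scaleN1r addrC.
pose h n y := ((x y - g n y) * (x y - g n y))%:E.
have mh n : measurable_fun D (h n).
  by apply/measurable_EFinP; apply: measurable_funM; exact: measurable_funB.
have h0 n y : D y -> (0 <= h n y)%E by rewrite lee_fin -expr2 sqr_ge0.
pose k y := ((x y - l y) * (x y - l y))%:E.
have mk : measurable_fun D k.
  by apply/measurable_EFinP; apply: measurable_funM; exact: measurable_funB.
have k0 y : D y -> (0 <= k y)%E by rewrite lee_fin -expr2 sqr_ge0.
have key : (\int[mu]_(y in D) k y <= (c ^+ 2)%:E)%E.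
  have -> : (\int[mu]_(y in D) k y = \int[mu]_(y in D) limn_einf (h ^~ y))%E.
    apply: ge0_ae_eq_integral => //.
    - rewrite /limn_einf; apply: measurableT_comp => //.
      apply: (@measurable_fun_limn_esup _ _ _ D (fun n x => - h n x)%E) => n.
      exact: measurableT_comp.
    - move=> y Dy; rewrite limn_einf_lim; apply: lime_ge; first exact: is_cvg_einfs.
      by apply: nearW => n; apply: le_ereal_inf_tmp => _ [m _ <-]; exact: h0.
    - apply: ae_imply gl => y hy Dy.
      have {}hy := hy Dy.
      suff /cvg_limn_einf_sup[-> _] : (h ^~ y) @ \oo --> k y by [].
      apply: cvg_EFin; first exact: nearW.
      by apply: cvgM; apply: cvgB => //; exact: cvg_cst.
  apply: le_trans (@fatou _ _ _ mu D _ h mh h0) _ => //.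
  rewrite limn_einf_lim; apply: lime_le; first exact: is_cvg_einfs.
  near=> n; apply: ereal_inf_le.
  exists (\int[mu]_(y in D) h n y)%E; first by exists n; [exact: leqnn|].
  have -> : (\int[mu]_(y in D) h n y = (L2inner (x \- g n) (x \- g n))%:E)%E.
    by rewrite L2innerE.
  rewrite lee_fin -sqr_L2norm// ler_sqr ?nnegrE ?L2norm_ge0//.
  by near: n.
have hxl : in_L2 (x \- l).
  apply/in_L2P; split; first exact: measurable_funB.
  apply/integrableP; split=> //.
  apply: (@le_lt_trans _ _ (\int[mu]_(y in D) k y)%E).
    rewrite le_eqVlt; apply/orP; left; apply/eqP/eq_integral => y _.
    by rewrite /= ger0_norm// -expr2 sqr_ge0.
  by apply: le_lt_trans key _; exact: ltry.
split=> //.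
by rewrite -ler_sqr ?nnegrE ?L2norm_ge0// -lee_fin sqr_L2norm// L2innerE.
Unshelve. all: by end_near. Qed.

Lemma L2_complete : rate_complete (fun f g : L2 R => L2inner f g).
Proof.
move=> x e esmall hx; have hB := @L2_semi_inner R.
have e0 k : 0 <= e k by apply: le_trans (hx k k (leqnn k)); exact: snorm_ge0.
have /choice[psi hpsi] : forall n, exists k, e k <= (2 ^ (n + 2))%:R^-1.
  by move=> n; apply: esmall; rewrite invr_gt0 ltr0n expn_gt0.
(* The modulus [e] may fail to decrease, so consecutive terms of the subsequence are compared
   through [x (psi n)], an index below both; each distance is at most 2^-(n+2). The summand [n]
   forces [phi n] to exceed any given index. *)
pose phi n := (n + \sum_(i < n.+1) psi i)%N.
have phiS n : phi n.+1 = ((phi n).+1 + psi n.+1)%N.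
  by rewrite /phi big_ord_recr/= addSn addnA.
have psi_phi n : (psi n <= phi n)%N.
  by rewrite /phi big_ord_recr/= addnA leq_addl.
pose g n : R -> R := x (phi n).
have hg n : in_L2 (g n) by exact: L2P.
have dist n m : L2norm (x n \- x m) = seminorm (fun f g : L2 R => L2inner f g) (x n - x m).
  by rewrite L2norm_seminorm.
have [n|l ml gl] := @ae_cvg_of_summable g hg.
  rewrite dist; apply: le_trans (snorm_dist hB (x (psi n)) _ _) _.
  have h1 : (psi n <= phi n.+1)%N.
    by apply: leq_trans (psi_phi n) _; rewrite phiS addSn ltnW// ltnS leq_addr.
  have := hx _ _ h1; have := hx _ _ (psi_phi n); rewrite (snormBC hB (x (phi n))).
  have := hpsi n; rewrite addn2 addn1 !expnS !natrM !invfM.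
  set a := (2 ^ n)%:R^-1; have a0 : 0 <= a by rewrite invr_ge0. lra.
have key k : in_L2 (x k \- l) /\ L2norm (x k \- l) <= e k.
  apply: (@fatou_L2 _ _ g) => //; first exact: L2P.
  exists k => // n /= kn; rewrite dist (snormBC hB); apply: hx.
  by apply: leq_trans kn _; exact: leq_addr.
have hl : in_L2 l.
  have := in_L2_submod_closed (-1) (key 0%N).1 (L2P (x 0%N)).
  rewrite (_ : -1 *: _ + _ = l)//; apply/funext => y /=.
  by rewrite !fctE scaleN1r opprB subrK.
by exists (toL2 hl) => n; rewrite L2norm_seminorm; exact: (key n).2.
Qed.

End RieszFischer.

(** * Smooth functions and test functions *)

Section Smooth.
Variable R : realType.
Implicit Types f g : R -> R.

Variant smooth f : Prop :=
  Smooth of forall n y, derivable (derive1n n f) y 1.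

(** Smoothness by coinduction: exhibiting a class of functions stable under differentiation replaces
    explicit formulas for the derivatives of order [n]. *)
Lemma smooth_of_class (S : (R -> R) -> Prop) :
  (forall f, S f -> exists2 g, S g & forall y : R, is_derive y 1 f (g y)) ->
  forall f, S f -> smooth f.
Proof.
move=> hS f Sf; constructor=> n.
suff [g [/hS[g' _ dg] ->]] : exists g, S g /\ derive1n n f = g.
  by move=> y; have := dg y.
elim: n => [|n [g [/hS[g' Sg' dg] ng]]]; first by exists f.
exists g'; split=> //; rewrite derive1nS ng; apply/funext => y.
by rewrite derive1E derive_val.
Qed.

Lemma smooth_derive1 f : smooth f -> smooth (derive1 f).
Proof.
case=> sf; constructor=> n y.
suff -> : derive1n n (derive1 f) = derive1n n.+1 f by exact: sf.
by rewrite /derive1n -iterSr.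
Qed.

Lemma smooth_is_derive f (y : R) : smooth f -> is_derive y 1 f (derive1 f y).
Proof. by case=> /(_ 0%N y)/derivableP; rewrite derive1E. Qed.

Lemma smooth_continuous f : smooth f -> continuous f.
Proof.
case=> sf y; apply: differentiable_continuous; apply/derivable1_diffP.
exact: (sf 0%N y).
Qed.

Lemma smooth_scaleD (a : R) f g : smooth f -> smooth g -> smooth (a *: f + g).
Proof.
pose S h := exists2 p : (R -> R) * (R -> R), smooth p.1 /\ smooth p.2
  & h = a *: p.1 + p.2.
move=> sf sg; apply: (@smooth_of_class S); last by exists (f, g).
move=> _ [[u v] /= [su sv] ->].
exists (a *: derive1 u + derive1 v).
  by exists (derive1 u, derive1 v) => //=; split; exact: smooth_derive1.
move=> y; have du := smooth_is_derive y su; have dv := smooth_is_derive y sv.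
by apply: is_deriveD.
Qed.

(** Products alone are not stable under the Leibniz rule; finite sums of products of smooth
    functions are. *)
Inductive product_class f g : (R -> R) -> Prop :=
| Product_mul f' g' : smooth f' -> smooth g' -> product_class f g (f' * g')
| Product_add u v : product_class f g u -> product_class f g v ->
    product_class f g (u + v).

Lemma smoothM f g : smooth f -> smooth g -> smooth (f * g).
Proof.
move=> sf sg; apply: (@smooth_of_class (product_class f g)); last exact: Product_mul.
move=> h ph; elim: ph => {h} [u v su sv|u v _ [u' pu' du] _ [v' pv' dv]].
  exists (u * derive1 v + derive1 u * v).
    by apply: Product_add; apply: Product_mul => //; exact: smooth_derive1.
  move=> y; have du := smooth_is_derive y su; have dv := smooth_is_derive y sv.
  by apply: is_derive_eq => /=; rewrite !fctE; congr (_ + _); rewrite mulrC.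
exists (u' + v'); first exact: Product_add.
by move=> y; have duy := du y; have dvy := dv y; apply: is_deriveD.
Qed.

Lemma smooth_affine f (a c : R) : smooth f -> smooth (fun y => f (a * y + c)).
Proof.
move=> sf.
pose S h := exists2 p : (R -> R) * R, smooth p.1 & h = fun y => p.2 * p.1 (a * y + c).
apply: (@smooth_of_class S); last first.
  by exists (f, 1) => //=; apply/funext => y; rewrite mul1r.
move=> _ [[u k] /= su ->].
exists (fun y => k * a * derive1 u (a * y + c)).
  by exists (derive1 u, k * a) => //=; exact: smooth_derive1.
move=> y; have du := smooth_is_derive (a * y + c) su.
have da : is_derive y 1 (fun y => a * y + c) a.
  by apply: is_derive_eq; rewrite addr0 scaler1.
have dc := @is_derive1_comp R u (fun y => a * y + c) y _ _ du da.
have -> : (fun y => k * u (a * y + c)) = k *: (u \o (fun y => a * y + c)) by [].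
have dk := is_deriveZ k dc; apply: (is_derive_eq dk).
by rewrite /= /GRing.scale/= mulrAC -mulrA.
Qed.

(* The derivatives of [exp (- 1 / t)] are linear combinations of the functions
   [t^-k exp (- 1 / t)], extended by zero to [t <= 0]. *)
Definition flat (k : nat) (t : R) : R :=
  if 0 < t then t^-1 ^+ k * expR (- t^-1) else 0.

Lemma flat_ge0 k t : 0 <= flat k t.
Proof.
rewrite /flat; case: ifPn => // t0.
by rewrite mulr_ge0 ?expR_ge0// exprn_ge0// invr_ge0 ltW.
Qed.

Lemma flat0_le1 t : flat 0 t <= 1.
Proof.
rewrite /flat; case: ifPn => // t0.
by rewrite expr0 mul1r -expR0 ler_expR oppr_le0 invr_ge0 ltW.
Qed.

(** With s = 1 / t, the exponential series gives s^(k+1) <= (k+1)! exp(s), that is, s^k exp(-s) <=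
    (k+1)! t. This linear bound controls the difference quotients at 0. *)
Lemma flat_le k t : flat k t <= (k.+1`!)%:R * `|t|.
Proof.
rewrite /flat; case: ifPn => [t0|_]; last by rewrite mulr_ge0.
have s0 : 0 < t^-1 by rewrite invr_gt0.
have := expR_ge1Dxn k (ltW s0); set s := t^-1 in s0 *.
have f0 : 0 < (k.+1`!)%:R :> R by rewrite ltr0n fact_gt0.
move=> h; have {}h : s ^+ k.+1 / (k.+1`!)%:R <= expR s by lra.
rewrite gtr0_norm// expRN ler_pdivrMr ?expR_gt0//.
rewrite -(ler_pM2r s0) -exprSr.
have -> : (k.+1`!)%:R * t * expR s * s = expR s * (k.+1`!)%:R.
  by rewrite /s; field; rewrite gt_eqF.
by rewrite -ler_pdivrMr.
Qed.

Lemma is_derive_flat k (t : R) :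
  is_derive t 1 (flat k) (flat k.+2 t - k%:R * flat k.+1 t).
Proof.
have [t0|t0|<-] := ltgtP 0 t.
- have h : \near t, t^-1 ^+ k * expR (- t^-1) = flat k t.
    near=> u; rewrite /flat ifT//.
    by near: u; exact: lt_nbhsr.
  apply: near_eq_is_derive h _.
  have tn0 : t != 0 by rewrite gt_eqF.
  have d1 : is_derive t 1 (fun y : R => y^-1) (- t ^- 2).
    by have := is_deriveV tn0 (is_derive_id t 1); rewrite scaler1.
  have d2 := is_deriveX k d1.
  have d3 : is_derive t 1 (fun y : R => expR (- y^-1)) (expR (- t^-1) * t ^- 2).
    have := @is_derive1_comp R expR (fun y => - y^-1) t _ _
      (is_derive_expR _) (is_deriveN d1).
    by rewrite opprK.
  have -> : (fun u : R => u^-1 ^+ k * expR (- u^-1)) =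
      ((fun u => u^-1) ^+ k) * (fun u => expR (- u^-1)).
    by apply/funext => u; rewrite !fctE.
  apply: (is_derive_eq (is_deriveM d2 d3)).
  rewrite /flat !ifT// !fctE /GRing.scale/= -exprVn; case: k {d2} => [|k].
    by rewrite mulr0n !(mul0r, mulr0) subr0 addr0 expr0 mul1r mulrC.
  rewrite -mulr_natl /= !exprS expr0; ring.
- have h : \near t, 0 = flat k t.
    near=> u; rewrite /flat ifF//; apply/negbTE; rewrite -leNgt ltW//.
    by near: u; exact: lt_nbhsl.
  apply: near_eq_is_derive h _.
  have tF : (0 < t) = false by apply/negbTE; rewrite -leNgt ltW.
  rewrite /flat !tF mulr0 subr0; exact: is_derive_cst.
rewrite /flat ltxx mulr0 subr0.
(* Dividing by [h] turns [flat k] into [flat k.+1], so [flat_le] at the next index makes the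
   quotient tend to zero. *)
have key : h^-1 *: (flat k (h *: 1 + 0) - flat k 0) @[h --> 0^'] --> (0 : R).
  apply/cvgr0Pnorm_le => e e0.
  have f0 : 0 < (k.+2`!)%:R :> R by rewrite ltr0n fact_gt0.
  near=> h.
  rewrite {2}/flat ltxx subr0 addr0 /GRing.scale/= mulr1.
  have -> : h^-1 * flat k h = flat k.+1 h.
    by rewrite /flat; case: ifP; rewrite ?mulr0// exprS mulrA.
  rewrite ger0_norm ?flat_ge0//; apply: le_trans (flat_le _ _) _.
  rewrite -ler_pdivlMl//; near: h.
  by apply: dnbhs0_le; rewrite mulr_gt0// invr_gt0.
apply: DeriveDef; first by apply/cvg_ex; exists 0; exact: key.
by apply/cvg_lim => //; exact: key.
Unshelve. all: by end_near. Qed.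

Inductive flat_class : (R -> R) -> Prop :=
| Flat_base k : flat_class (flat k)
| Flat_comb a u v : flat_class u -> flat_class v -> flat_class (a *: u + v).

Lemma smooth_flat k : smooth (flat k).
Proof.
apply: (@smooth_of_class flat_class); last exact: Flat_base.
move=> h ph; elim: ph => {h} [{}k|a u v _ [u' pu' du] _ [v' pv' dv]].
  exists (- k%:R *: flat k.+1 + flat k.+2).
    by apply: Flat_comb; exact: Flat_base.
  move=> t; apply: (is_derive_eq (is_derive_flat k t)).
  by rewrite !fctE /GRing.scale/= mulNr addrC.
exists (a *: u' + v'); first exact: Flat_comb.
move=> y; have duy := du y; have dvy := dv y.
by apply: is_deriveD.
Qed.

End Smooth.

(** * Test functions, integration by parts and approximate indicators *)

Section TestFunctions.
Variable R : realType.
Local Notation mu := (@lebesgue_measure R).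
Local Notation D := (`]0, 1[%classic : set R).
Implicit Types f g phi : R -> R.

Lemma test_function_intro phi (K : set R) : smooth phi -> compact K -> K `<=` D ->
  (forall y, phi y != 0 -> K y) -> test_function phi.
Proof.
move=> [sphi] cK KD phiK.
have clK : closure [set y | phi y != 0] `<=` K.
  have clK : closed K by apply: compact_closed => //; exact: Rhausdorff.
  by rewrite (closure_id K).1//; exact: closure_subset.
split; [exact: sphi| |exact: subset_trans KD].
by apply: subclosed_compact cK clK; exact: closed_closure.
Qed.

Lemma test_function_smooth phi : test_function phi -> smooth phi.
Proof. by case=> sphi _ _; constructor. Qed.

Lemma test_function0 : test_function (0 : R -> R).
Proof.
apply: (@test_function_intro _ set0); last by move=> y /eqP.
- apply: (@smooth_of_class _ (fun f => f = 0)) => // f ->.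
  by exists 0 => // y; exact: is_derive_cst.
- exact: compact0.
- exact: sub0set.
Qed.

Lemma test_function_scaleD (a : R) phi psi : test_function phi ->
  test_function psi -> test_function (a *: phi + psi).
Proof.
move=> hphi hpsi; have [_ c1 s1] := hphi; have [_ c2 s2] := hpsi.
apply: (@test_function_intro _
  (closure [set y | phi y != 0] `|` closure [set y | psi y != 0])).
- by apply: smooth_scaleD; exact: test_function_smooth.
- exact: compactU.
- by move=> y [/s1|/s2].
move=> y; have [p0|p0] := eqVneq (phi y) 0; last first.
  by left; exact: subset_closure.
rewrite !fctE p0 scaler0 add0r => q0.
by right; exact: subset_closure.
Qed.

Lemma test_function_derive1 phi : test_function phi -> test_function (derive1 phi).
Proof.
move=> hphi; have [_ c1 s1] := hphi.
apply: (@test_function_intro _ (closure [set y | phi y != 0])) => //.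
  exact/smooth_derive1/test_function_smooth.
move=> y dy0; apply: contrapT => yK.
(* Off its closed support [phi] vanishes on a whole neighbourhood, so its derivative vanishes there
   too. *)
have : \near y, 0 = phi y.
  have := open_nbhs_nbhs (conj (closed_openC (@closed_closure _ [set y | phi y != 0])) yK).
  apply: filterS => z /= zK; apply/esym/eqP; apply: contrapT => /negP z0.
  exact/zK/subset_closure.
move/near_eq_derive => /(_ 1); rewrite -derive1E -[in RHS]derive1E.
by rewrite derive1_cst => h; rewrite -h eqxx in dy0.
Qed.

Lemma test_function_out phi y : test_function phi -> ~ D y -> phi y = 0.
Proof.
move=> [_ _ sD] Dy; apply/eqP; apply: contrapT => /negP p0.
exact/Dy/sD/subset_closure.
Qed.

Lemma continuous_in_L2 f : continuous f -> in_L2 f.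
Proof.
move=> cf.
have [|c0 c1 hc] := @EVT_max R (fun y => `|f y|) 0 1 ler01.
  apply: continuous_subspaceT => y; apply: continuous_comp; first exact: cf.
  exact: norm_continuous.
apply: (@in_L2_bounded _ _ `|f c0|).
  apply: measurable_funS measurableT _ _ => //.
  exact: continuous_measurable_fun.
by move=> y Dy; apply: hc; apply: subset_itv_oo_cc.
Qed.

Lemma test_function_in_L2 phi : test_function phi -> in_L2 phi.
Proof.
by move=> h; apply: continuous_in_L2; apply/smooth_continuous/test_function_smooth.
Qed.

Lemma Rintegral_oo_cc f : {within `[0, 1], continuous f} ->
  \int[mu]_(x in `]0, 1[) f x = \int[mu]_(x in `[0, 1]) f x.
Proof.
move=> cf.
have icc : mu.-integrable `[0, 1] (EFin \o f).
  by apply: continuous_compact_integrable => //; exact: segment_compact.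
rewrite Rintegral_itv_bndo_bndc.
  rewrite Rintegral_itv_obnd_cbnd//.
  by apply: integrableS icc => //; apply: subset_itv_oc_cc.
by apply: integrableS icc => //; apply: subset_itv_oo_cc.
Qed.

Lemma derivable_LRcontinuous f : (forall y : R, derivable f y 1) ->
  derivable_oo_LRcontinuous f 0 1.
Proof.
move=> df.
have cf : continuous f.
  by move=> y; apply: differentiable_continuous; apply/derivable1_diffP.
by split=> [y _| |]; [exact: df|exact/cvg_at_right_filter/cf|exact/cvg_at_left_filter/cf].
Qed.

Lemma weak_derivative_test phi : test_function phi -> weak_derivative phi (derive1 phi).
Proof.
move=> hphi psi hpsi.
have sphi := test_function_smooth hphi; have spsi := test_function_smooth hpsi.
have cphi := smooth_continuous sphi; have cpsi := smooth_continuous spsi.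
have cphi' := smooth_continuous (smooth_derive1 sphi).
have cpsi' := smooth_continuous (smooth_derive1 spsi).
rewrite /L2inner !Rintegral_oo_cc; first last.
- by apply: continuous_subspaceT => y; apply: continuousM; [exact: cphi|exact: cpsi'].
- by apply: continuous_subspaceT => y; apply: continuousM; [exact: cphi'|exact: cpsi].
have n0 : ~ D 0 by rewrite /= in_itv/= ltxx.
have n1 : ~ D 1 by rewrite /= in_itv/= ltxx andbF.
rewrite (@Rintegration_by_parts _ phi psi (derive1 phi) (derive1 psi)) //.
- by rewrite !(test_function_out hphi) // !mul0r subrr sub0r.
- exact: continuous_subspaceT.
- by apply: derivable_LRcontinuous => y; case: sphi => /(_ 0%N y).
- exact: continuous_subspaceT.
- by apply: derivable_LRcontinuous => y; case: spsi => /(_ 0%N y).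
Qed.

(** With N = m + 1, the factors vanish for y <= 1/N and for y >= b. Each tends to 1 elsewhere on ]0,
    b[ as the argument of [flat 0] grows, so the product converges to the indicator of ]0, b[ while
    staying between 0 and 1. The shift by -1 keeps the support away from 0. *)
Definition flat_bump (b : R) (m : nat) (y : R) : R :=
  flat 0 (m.+1%:R * y + -1) * flat 0 (- m.+1%:R * y + m.+1%:R * b).

Lemma flat_bump_test b m : 0 < b < 1 -> test_function (flat_bump b m).
Proof.
move=> /andP[b0 b1].
apply: (@test_function_intro _ `[m.+1%:R^-1, b]).
- have := smoothM (smooth_affine m.+1%:R (-1) (smooth_flat R 0))
    (smooth_affine (- m.+1%:R) (m.+1%:R * b) (smooth_flat R 0)).
  by [].
- exact: segment_compact.
- move=> y; rewrite /= !in_itv/= => /andP[y1 y2].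
  by rewrite (le_lt_trans y2)// andbT (lt_le_trans _ y1)// invr_gt0.
move=> y; rewrite /flat_bump mulf_eq0 negb_or => /andP[h1 h2].
have m0 : 0 < m.+1%:R :> R by [].
move: h1 h2; rewrite /flat; case: ifPn => [h1 _|_ /eqP//].
case: ifPn => [h2 _|_ /eqP//].
rewrite /= in_itv/=; apply/andP; split.
  by rewrite -(ler_pM2l m0) divff ?gt_eqF//; lra.
by rewrite -(ler_pM2l m0); lra.
Qed.

Lemma flat_bump_cvg b y : 0 < y ->
  (fun m => flat_bump b m y) @ \oo --> (if y < b then 1 else 0 : R).
Proof.
move=> y0.
have flat_cvg (c d : R) : 0 < c ->
    (fun m => flat 0 (m.+1%:R * c + d)) @ \oo --> (1 : R).
  move=> c0.
  have h : (fun m => m.+1%:R * c + d : R) @ \oo --> +oo.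
    apply/cvgryPge => A.
    near=> m; rewrite -lerBlDr -ler_pdivrMr//.
    apply: le_trans (_ : m%:R <= _); last by rewrite ler_nat.
    near: m; exact: nbhs_infty_ger.
  have /cvgryPgt /(_ 0) h0 := h.
  have e : (fun m => expR (- (m.+1%:R * c + d)^-1)) @ \oo --> (expR (- 0) : R).
    apply: continuous_cvg; first exact: continuous_expR.
    apply: cvgN; apply/gtr0_cvgV0; [exact: h0|exact: h].
  rewrite oppr0 expR0 in e; apply: cvg_trans e; apply: near_eq_cvg; near=> m.
  rewrite /flat ifT ?expr0 ?mul1r//.
  by near: m; exact: h0.
case: ifPn => yb.
  rewrite -[1]mulr1; apply: cvgM; first exact: flat_cvg.
  rewrite (_ : (fun m => _) = (fun m => flat 0 (m.+1%:R * (b - y) + 0))).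
    by apply: flat_cvg; rewrite subr_gt0.
  by apply/funext => m; congr flat; ring.
rewrite (_ : (fun m => _) = cst 0); first exact: cvg_cst.
apply/funext => m; rewrite /flat_bump /= [X in _ * X]/flat ifF ?mulr0//.
apply/negbTE; rewrite -leNgt; rewrite -leNgt in yb.
have m0 : 0 < m.+1%:R :> R by [].
by have := ler_wpM2l (ltW m0) yb; lra.
Unshelve. all: by end_near. Qed.

End TestFunctions.

(** * The fundamental lemma of the calculus of variations *)

Section FundamentalLemma.
Variable R : realType.
Local Notation mu := (@lebesgue_measure R).
Local Notation D := (`]0, 1[%classic : set R).
Implicit Types f g phi : R -> R.

Lemma L2norm_eq0P f : in_L2 f -> L2norm f = 0 <-> ae01 (fun y => f y = 0).
Proof.
move=> hf; have mf := in_L2_measurable hf.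
have mff : measurable_fun D (EFin \o (f \* f)).
  by apply/measurable_EFinP; exact: measurable_funM.
have h := ae_eq_integral_abs mu (measurable_itv _) mff.
have e : (\int[mu]_(y in D) `|(EFin \o (f \* f)%R) y|)%E = (L2inner f f)%:E.
  rewrite L2innerE//; apply: eq_integral => y _.
  by rewrite /= ger0_norm// -expr2 sqr_ge0.
rewrite e in h; split=> [f0|f0].
  have : (L2inner f f)%:E = 0%E by rewrite -sqr_L2norm// f0 expr0n.
  move/h; apply: ae_imply => y /[swap] yD /(_ yD)/= [] /eqP.
  by rewrite mulf_eq0 orbb => /eqP.
suff : (L2inner f f)%:E = 0%E.
  by rewrite -sqr_L2norm// => -[] /eqP; rewrite sqrf_eq0 => /eqP.
apply/h; apply: ae_imply f0 => y hy yD /=.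
by rewrite hy// mulr0.
Qed.

Lemma integral_below_eq0 g b : in_L2 g ->
  (forall phi, test_function phi -> L2inner g phi = 0) -> 0 < b < 1 ->
  (\int[mu]_(y in D) (g y * (if y < b then 1 else 0))%:E = 0)%E.
Proof.
move=> hg g0 hb; have mg := in_L2_measurable hg.
have tb m := flat_bump_test m hb.
have mb m : measurable_fun D (flat_bump b m).
  by apply: in_L2_measurable; exact: test_function_in_L2.
have mI : measurable_fun D (fun y => if y < b then 1 else 0 : R).
  apply: (@measurable_fun_cvg _ _ _ D (flat_bump b)) => // y.
  by rewrite /= in_itv/= => /andP[y0 _]; exact: flat_bump_cvg.
have gI : mu.-integrable D (fun y => `|g y|%:E).
  have := in_L2_integrableM (in_L2_norm hg) (in_L2_cst 1).
  by apply: eq_integrable => // y _ /=; rewrite mulr1.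
have := @dominated_cvg _ _ _ mu D (measurable_itv _)
  (fun m y => (g y * flat_bump b m y)%:E)
  (fun y => (g y * (if y < b then 1 else 0))%:E) (fun y => `|g y|%:E).
rewrite /=; set I := (X in _ -> _ --> X).
have -> : (fun m => \int[mu]_(y in D) (g y * flat_bump b m y)%:E)%E = cst 0%E.
  apply/funext => m; rewrite -L2innerE ?g0//; exact: test_function_in_L2.
move=> h; have {}h : (fun=> 0%E : \bar R) @ \oo --> I.
  apply: h => //.
  - move=> m; apply/measurable_EFinP; by apply: measurable_funM => //; exact: mb.
  - move=> y; rewrite /= in_itv/= => /andP[y0 _]; apply: cvg_EFin; first exact: nearW.
    by apply: cvgM; [exact: cvg_cst|exact: flat_bump_cvg].
  - move=> m y Dy; rewrite lee_fin normrM ler_piMr// /flat_bump normrM.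
    by rewrite !ger0_norm ?flat_ge0// mulr_ile1 ?flat_ge0 ?flat0_le1.
by rewrite -[LHS](cvg_lim _ h)// lim_cst.
Qed.

(** The integral of [g] over ]0, b[ vanishes for every [b], so the primitive of [g] is zero on the
    interval; Lebesgue differentiation recovers [g] from it almost everywhere. *)
Lemma L2_orthogonal_test g : in_L2 g ->
  (forall phi, test_function phi -> L2inner g phi = 0) -> L2norm g = 0.
Proof.
move=> hg g0; apply/L2norm_eq0P => //; have mg := in_L2_measurable hg.
have ig : mu.-integrable D (EFin \o g).
  have := in_L2_integrableM hg (in_L2_cst 1).
  by apply: eq_integrable => // y _ /=; rewrite mulr1.
have iT : mu.-integrable setT (EFin \o (g \_ D)).
  rewrite -restrict_EFin; exact: (integrable_mkcond _ _).1.
pose F y := \int[mu]_(t in [set` Interval -oo%O (BRight y)]) (g \_ D) t.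
have F0 y : 0 < y < 1 -> F y = 0.
  move=> hy; rewrite /F -Rintegral_itv_bndo_bndc; last exact: integrableS iT.
  rewrite Rintegral_mkcond.
  have := integral_below_eq0 hg g0 hy.
  rewrite integral_mkcond => /(congr1 fine) /= e; rewrite -[RHS]e.
  rewrite /Rintegral; congr fine; apply: eq_integral => t _.
  rewrite restrict_EFin /=; congr EFin; rewrite !patchE.
  have [ty|ty] := boolP (t < y).
    by rewrite mem_set/= ?in_itv//=; case: ifP; rewrite ?mulr1.
  rewrite memNset/=; last by rewrite in_itv/=; exact/negP.
  by case: ifP; rewrite ?mulr0.
have := lebesgue_differentiation (integrable_locally (measurable_itv `]0, 1[) ig).
apply: ae_imply => x hx xD.
have x01 : 0 < x < 1 by move: xD; rewrite in_itv.
have i1 : mu.-integrable [set` Interval -oo%O (BRight (1 : R))] (EFin \o (g \_ D)).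
  exact: integrableS iT.
have := @FTC1_lebesgue_pt R (g \_ D) -oo%O x 1 (proj2 (andP x01)) i1.
move=> /(_ (ltNyr x) hx)[_].
rewrite patchE mem_set// => <-.
rewrite -/F derive1E.
have : \near x, 0 = F x.
  near=> z; rewrite F0//; apply/andP; split; near: z.
    by apply: lt_nbhsr; case/andP: x01.
  by apply: lt_nbhsl; case/andP: x01.
by move/near_eq_derive => <-; rewrite -derive1E derive1_cst.
Unshelve. all: by end_near. Qed.

End FundamentalLemma.

(** * The spaces H^1 and H_0^1 *)

(** A limit reached at a worse rate is enough, because the distance from [x n] to it is at most
    [e n] plus a tail that can be made arbitrarily small. This serves norms built from two
    components, where the rates add up. *)
Lemma rate_complete_of_limits (R : realType) (X : lmodType R) (B : X -> X -> R) :
  semi_inner_product B ->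
  (forall (x : nat -> X) (e : nat -> R), (forall d, 0 < d -> exists n, e n <= d) ->
    (forall n m, (n <= m)%N -> seminorm B (x m - x n) <= e n) ->
    exists l, exists c : R, forall n, seminorm B (x n - l) <= c * e n) ->
  rate_complete B.
Proof.
move=> hB h x e esmall hx; have [l [c hl]] := h x e esmall hx.
exists l => n; rewrite -subr_le0; apply: (@le0_of_small _ _ (1 + `|c|)) => d d0.
have [k hk] := esmall d d0; pose m := maxn n k.
have ek0 : 0 <= e k by apply: le_trans (hx k k (leqnn k)); exact: snorm_ge0.
have h1 : seminorm B (x m - l) <= e k + `|c| * e k.
  apply: le_trans (snorm_dist hB (x k) _ _) _; apply: lerD.
    exact: hx (leq_maxr _ _).
  by apply: le_trans (hl k) _; apply: ler_wpM2r => //; exact: ler_norm.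
have := snorm_dist hB (x m) (x n) l; rewrite (snormBC hB (x n) (x m)).
have := hx _ _ (leq_maxl n k).
have : e k * (1 + `|c|) <= d * (1 + `|c|) by apply: ler_wpM2r => //; rewrite addr_ge0.
rewrite -/m; lra.
Qed.

Section Sobolev.
Variable R : realType.
Implicit Types u v w f g phi psi : R -> R.

Lemma L2inner_linr (a : R) f g h : in_L2 f -> in_L2 g -> in_L2 h ->
  L2inner h (a *: f + g) = a * L2inner h f + L2inner h g.
Proof. by move=> *; rewrite L2innerC L2inner_linl// !(L2innerC h). Qed.

Lemma in_L2B f g : in_L2 f -> in_L2 g -> in_L2 (f - g).
Proof.
by move=> hf hg; have := in_L2_submod_closed (-1) hg hf; rewrite scaleN1r addrC.
Qed.

Lemma L2inner_eq0 f g : in_L2 f -> in_L2 g -> L2norm f = 0 -> L2inner f g = 0.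
Proof.
move=> hf hg f0; apply/eqP; rewrite -normr_eq0 eq_le normr_ge0 andbT.
by apply: le_trans (L2_CS hf hg) _; rewrite f0 mul0r.
Qed.

Lemma L2inner_congr f f' g : in_L2 f -> in_L2 f' -> in_L2 g ->
  L2norm (f - f') = 0 -> L2inner f g = L2inner f' g.
Proof.
move=> hf hf' hg h; have hff := in_L2B hf hf'.
have -> : f = 1 *: (f - f') + f' by rewrite scale1r subrK.
by rewrite L2inner_linl// L2inner_eq0// mulr0 add0r.
Qed.

Lemma dyP u : in_H1 u -> in_L2 (dy u) /\ weak_derivative u (dy u).
Proof. by case=> _ /(xgetPex (cst 0 : R -> R)). Qed.

Lemma in_L2_dy u : in_H1 u -> in_L2 (dy u). Proof. by case/dyP. Qed.
Lemma in_H1_L2 u : in_H1 u -> in_L2 u. Proof. by case. Qed.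

Lemma weak_derivative_unique u g g' : in_L2 g -> in_L2 g' ->
  weak_derivative u g -> weak_derivative u g' -> L2norm (g - g') = 0.
Proof.
move=> hg hg' ug ug'; apply: L2_orthogonal_test; first exact: in_L2B.
move=> phi hphi; have hphi2 := test_function_in_L2 hphi.
rewrite addrC -scaleN1r L2inner_linl//.
by have := ug phi hphi; rewrite (ug' phi hphi); lra.
Qed.

Lemma weak_derivative_scaleD (a : R) u v g h : in_L2 u -> in_L2 v -> in_L2 g ->
  in_L2 h -> weak_derivative u g -> weak_derivative v h ->
  weak_derivative (a *: u + v) (a *: g + h).
Proof.
move=> hu hv hg hh ug vh phi hphi.
have hphi2 := test_function_in_L2 hphi.
have hphi3 := test_function_in_L2 (test_function_derive1 hphi).
by rewrite !L2inner_linl// ug// vh//; lra.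
Qed.

Lemma in_H1_intro u g : in_L2 u -> in_L2 g -> weak_derivative u g -> in_H1 u.
Proof. by move=> hu hg ug; split=> //; exists g. Qed.

Lemma dy_eq u g : in_H1 u -> in_L2 g -> weak_derivative u g -> L2norm (dy u - g) = 0.
Proof. by move=> /dyP[h1 h2] hg ug; apply: weak_derivative_unique h2 ug. Qed.

Lemma in_H1_scaleD (a : R) u v : in_H1 u -> in_H1 v -> in_H1 (a *: u + v).
Proof.
move=> hu hv; have [h1 h2] := dyP hu; have [h3 h4] := dyP hv.
apply: (@in_H1_intro _ (a *: dy u + dy v)).
- by apply: in_L2_submod_closed; exact: in_H1_L2.
- exact: in_L2_submod_closed.
- by apply: weak_derivative_scaleD => //; exact: in_H1_L2.
Qed.

Lemma in_H1_test phi : test_function phi -> in_H1 phi.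
Proof.
move=> hphi; apply: (@in_H1_intro _ (derive1 phi)).
- exact: test_function_in_L2.
- exact/test_function_in_L2/test_function_derive1.
- exact: weak_derivative_test.
Qed.

Lemma dy_test phi : test_function phi -> L2norm (dy phi - derive1 phi) = 0.
Proof.
move=> hphi; apply: dy_eq; first exact: in_H1_test.
  exact/test_function_in_L2/test_function_derive1.
exact: weak_derivative_test.
Qed.

Definition H1inner u v := L2inner u v + L2inner (dy u) (dy v).

(** The choice made by [dy] need not respect linear combinations pointwise; uniqueness of weak
    derivatives makes the discrepancy null, hence invisible to the inner product. *)
Lemma L2inner_dy_linl (a : R) u v f : in_H1 u -> in_H1 v -> in_L2 f ->
  L2inner (dy (a *: u + v)) f = a * L2inner (dy u) f + L2inner (dy v) f.
Proof.
move=> hu hv hf; have [h1 h2] := dyP hu; have [h3 h4] := dyP hv.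
have huv := in_H1_scaleD a hu hv; have h5 := in_L2_submod_closed a h1 h3.
rewrite -(L2inner_linl a h1 h3 hf).
apply: (L2inner_congr (in_L2_dy huv) h5 hf).
by apply: dy_eq => //; apply: weak_derivative_scaleD => //; exact: in_H1_L2.
Qed.

Lemma H1inner_linl (a : R) u v w : in_H1 u -> in_H1 v -> in_H1 w ->
  H1inner (a *: u + v) w = a * H1inner u w + H1inner v w.
Proof.
move=> hu hv hw; rewrite /H1inner (L2inner_dy_linl a hu hv (in_L2_dy hw)).
by rewrite (L2inner_linl a (in_H1_L2 hu) (in_H1_L2 hv) (in_H1_L2 hw)) mulrDr addrACA.
Qed.

Lemma H1normE u : in_H1 u -> H1norm u = Num.sqrt (H1inner u u).
Proof.
by move=> hu; rewrite /H1norm !sqr_L2norm//; [exact: in_L2_dy|exact: in_H1_L2].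
Qed.

Lemma test_function_H10 phi : test_function phi -> in_H10 phi.
Proof.
move=> hphi; split=> [|e e0]; first exact: in_H1_test.
exists phi; split=> //.
rewrite (_ : phi \- phi = 0); last by apply/funext => y; rewrite /= subrr.
have h0 : in_H1 (0 : R -> R) by exact/in_H1_test/test_function0.
have := H1inner_linl 1 h0 h0 h0; rewrite scale1r !addr0 mul1r => h.
have h00 : H1inner (0 : R -> R) 0 = 0 by lra.
by rewrite (H1normE h0) h00 sqrtr0.
Qed.

Definition H1pred : {pred R -> R} := fun f => `[< in_H1 f >].

Fact H1pred_closed : submod_closed H1pred.
Proof.
split=> [|a f g]; first exact/asboolP/in_H1_test/test_function0.
by move=> /asboolP hf /asboolP hg; exact/asboolP/in_H1_scaleD.
Qed.

HB.instance Definition _ :=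
  GRing.isSubmodClosed.Build R (R -> R) H1pred H1pred_closed.

Record H1 := MkH1 { H1_val :> R -> R; H1_valP : H1_val \in H1pred }.
HB.instance Definition _ := [isSub for H1_val].
HB.instance Definition _ := [Choice of H1 by <:].
HB.instance Definition _ := [SubChoice_isSubLmodule of H1 by <:].

Definition toH1 f (hf : in_H1 f) : H1 := @MkH1 f (asboolT hf).

Lemma H1P (f : H1) : in_H1 f.
Proof. by case: f => f /= /asboolP. Qed.

Lemma H1_semi_inner : semi_inner_product (fun u v : H1 => H1inner u v).
Proof.
split=> [a u v w|u v|u].
- by rewrite -H1inner_linl//; exact: H1P.
- by rewrite /H1inner L2innerC (L2innerC (dy u)).
- have hu := H1P u; have hL := in_H1_L2 hu; have hd := in_L2_dy hu.
  by rewrite /H1inner -!sqr_L2norm// addr_ge0// sqr_ge0.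
Qed.

Lemma H1norm_seminorm (u : H1) : seminorm (fun u v : H1 => H1inner u v) u = H1norm u.
Proof. by rewrite H1normE//; exact: H1P. Qed.

Lemma H1norm_triangle u v : in_H1 u -> in_H1 v -> H1norm (u + v) <= H1norm u + H1norm v.
Proof.
move=> hu hv; have := snormD H1_semi_inner (toH1 hu) (toH1 hv).
by rewrite !H1norm_seminorm.
Qed.

Lemma H1normZ (a : R) u : in_H1 u -> H1norm (a *: u) = `|a| * H1norm u.
Proof.
move=> hu; have := snormZ H1_semi_inner a (toH1 hu).
by rewrite !H1norm_seminorm.
Qed.

Lemma in_H1B u v : in_H1 u -> in_H1 v -> in_H1 (u - v).
Proof.
by move=> hu hv; have := in_H1_scaleD (-1) hv hu; rewrite scaleN1r addrC.
Qed.

Lemma in_H10_scaleD (a : R) u v : in_H10 u -> in_H10 v -> in_H10 (a *: u + v).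
Proof.
move=> [hu cu] [hv cv]; split=> [|e e0]; first exact: in_H1_scaleD.
have a0 : 0 < `|a| + 1 by rewrite ltr_wpDl.
have [phi [tphi hphi]] := cu _ (divr_gt0 (divr_gt0 e0 (ltr0n R 2)) a0).
have [psi [tpsi hpsi]] := cv _ (divr_gt0 e0 (ltr0n R 2)).
exists (a *: phi + psi); split; first exact: test_function_scaleD.
have h1 := in_H1_test tphi; have h2 := in_H1_test tpsi.
have -> : (a *: u + v) \- (a *: phi + psi) = a *: (u - phi) + (v - psi).
  by apply/funext => y; rewrite /= !fctE /GRing.scale/=; ring.
have hup := in_H1B hu h1; have hvp := in_H1B hv h2.
have hz : in_H1 (a *: (u - phi)).
  have := in_H1_scaleD a hup (in_H1_test (@test_function0 R)).
  by rewrite addr0.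
apply: le_lt_trans (H1norm_triangle hz hvp) _.
rewrite H1normZ// [ltRHS]splitr; apply: ler_ltD => //.
move: hphi; rewrite ltr_pdivlMr// => hphi.
apply: le_trans (_ : H1norm (u - phi) * (`|a| + 1) <= _); last exact: ltW.
by rewrite mulrC ler_wpM2l ?sqrtr_ge0// lerDl.
Qed.

Definition H10pred : {pred R -> R} := fun f => `[< in_H10 f >].

Fact H10pred_closed : submod_closed H10pred.
Proof.
split=> [|a f g]; first exact/asboolP/test_function_H10/test_function0.
by move=> /asboolP hf /asboolP hg; exact/asboolP/in_H10_scaleD.
Qed.

HB.instance Definition _ :=
  GRing.isSubmodClosed.Build R (R -> R) H10pred H10pred_closed.

Record H10 := MkH10 { H10_val :> R -> R; H10_valP : H10_val \in H10pred }.
HB.instance Definition _ := [isSub for H10_val].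
HB.instance Definition _ := [Choice of H10 by <:].
HB.instance Definition _ := [SubChoice_isSubLmodule of H10 by <:].

Definition toH10 f (hf : in_H10 f) : H10 := @MkH10 f (asboolT hf).

Lemma H10P (f : H10) : in_H10 f.
Proof. by case: f => f /= /asboolP. Qed.

Lemma H10_H1 (f : H10) : in_H1 f.
Proof. by have [] := H10P f. Qed.

Lemma H10_semi_inner : semi_inner_product (fun u v : H10 => H1inner u v).
Proof.
have [h1 h2 h3] := H1_semi_inner; split=> [a u v w|u v|u].
- exact: (h1 a (toH1 (H10_H1 u)) (toH1 (H10_H1 v)) (toH1 (H10_H1 w))).
- exact: (h2 (toH1 (H10_H1 u)) (toH1 (H10_H1 v))).
- exact: (h3 (toH1 (H10_H1 u))).
Qed.

Lemma H10_seminorm (u : H10) : seminorm (fun u v : H10 => H1inner u v) u = H1norm u.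
Proof. by rewrite H1normE//; exact: H10_H1. Qed.

Lemma L2norm_le_H1norm u : L2norm u <= H1norm u.
Proof.
rewrite -ler_sqr ?nnegrE ?L2norm_ge0 ?sqrtr_ge0// sqr_sqrtr.
  by rewrite lerDl sqr_ge0.
by rewrite addr_ge0// sqr_ge0.
Qed.

Lemma L2norm_dy_le_H1norm u : L2norm (dy u) <= H1norm u.
Proof.
rewrite -ler_sqr ?nnegrE ?L2norm_ge0 ?sqrtr_ge0// sqr_sqrtr.
  by rewrite lerDr sqr_ge0.
by rewrite addr_ge0// sqr_ge0.
Qed.

Lemma H1norm_le u : H1norm u <= L2norm u + L2norm (dy u).
Proof.
have h := L2norm_ge0 u; have h' := L2norm_ge0 (dy u).
rewrite -ler_sqr ?nnegrE ?addr_ge0 ?sqrtr_ge0// sqr_sqrtr.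
  by rewrite sqrrD; have := mulr_ge0 h h'; lra.
by rewrite addr_ge0// sqr_ge0.
Qed.

End Sobolev.

(** * Completeness of H_0^1(0,1) *)

Section SobolevComplete.
Variable R : realType.
Implicit Types u v f g phi : R -> R.

Lemma L2norm_triangle f g : in_L2 f -> in_L2 g -> L2norm (f + g) <= L2norm f + L2norm g.
Proof.
move=> hf hg; have := snormD (@L2_semi_inner R) (toL2 hf) (toL2 hg).
by rewrite !L2norm_seminorm.
Qed.

Lemma L2normN f : in_L2 f -> L2norm (- f) = L2norm f.
Proof.
move=> hf; have := snormN (@L2_semi_inner R) (toL2 hf).
by rewrite !L2norm_seminorm.
Qed.

Lemma L2normBC f g : in_L2 f -> in_L2 g -> L2norm (f - g) = L2norm (g - f).
Proof. by move=> hf hg; rewrite -[LHS]L2normN ?opprB//; exact: in_L2B. Qed.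

Lemma L2norm_congr f f' : in_L2 f -> in_L2 f' -> L2norm (f - f') = 0 ->
  L2norm f = L2norm f'.
Proof.
move=> hf hf' h; have h1 := in_L2B hf hf'; have h2 := in_L2B hf' hf.
apply/eqP; rewrite eq_le; apply/andP; split.
  by have := L2norm_triangle h1 hf'; rewrite subrK h add0r.
by have := L2norm_triangle h2 hf; rewrite subrK (L2normBC hf' hf) h add0r.
Qed.

Lemma L2norm_dyB u v g : in_H1 u -> in_H1 v -> in_L2 g -> L2norm (dy v - g) = 0 ->
  L2norm (dy (u - v)) = L2norm (dy u - g).
Proof.
move=> hu hv hg vg; have huv := in_H1B hu hv.
have hdu := in_L2_dy hu; have hdv := in_L2_dy hv; have hduv := in_L2_dy huv.
have hd := in_L2B hdu hg.
apply: L2norm_congr => //.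
have h1 : L2norm (dy (u - v) - (dy u - dy v)) = 0.
  apply: dy_eq => //; first exact: in_L2B.
  have := weak_derivative_scaleD (-1) (in_H1_L2 hv) (in_H1_L2 hu) hdv hdu
    (dyP hv).2 (dyP hu).2.
  by rewrite !scaleN1r addrC [- _ + _]addrC.
have h2 : in_L2 (dy (u - v) - (dy u - dy v)) by apply: in_L2B => //; exact: in_L2B.
have h3 : in_L2 (g - dy v) by exact: in_L2B.
apply/eqP; rewrite eq_le L2norm_ge0 andbT.
have := L2norm_triangle h2 h3.
rewrite h1 (L2normBC hg hdv) vg addr0; congr (L2norm _ <= _).
apply/funext => y; rewrite !fctE; ring.
Qed.

Lemma H10_complete : rate_complete (fun u v : H10 R => H1inner u v).
Proof.
have hB := @H10_semi_inner R.
apply: (rate_complete_of_limits hB) => x e esmall hx.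
have hN n m : seminorm (fun u v : H10 R => H1inner u v) (x m - x n) = H1norm (x m - x n).
  exact: H10_seminorm.
have hx1 n : in_H1 (x n) by exact: H10_H1.
pose y n : L2 R := toL2 (in_H1_L2 (hx1 n)).
pose z n : L2 R := toL2 (in_L2_dy (hx1 n)).
have [||l hl] := @L2_complete R y e => //.
  move=> n m nm; rewrite L2norm_seminorm.
  apply: le_trans (L2norm_le_H1norm _) _.
  by have := hx n m nm; rewrite hN.
have [||g hg] := @L2_complete R z e => //.
  move=> n m nm; rewrite L2norm_seminorm.
  have h0 : L2norm (dy (x n) - dy (x n)) = 0.
    by rewrite subrr; apply/L2norm_eq0P; [exact: in_L20|apply: aeW].
  rewrite (_ : L2norm _ = L2norm (dy (x m) - dy (x n)))//.
  rewrite -(L2norm_dyB (hx1 m) (hx1 n) (in_L2_dy (hx1 n)) h0).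
  apply: le_trans (L2norm_dy_le_H1norm _) _.
  by have := hx n m nm; rewrite hN.
pose lf : R -> R := l; pose gf : R -> R := g; pose xf n : R -> R := x n.
have hlf : in_L2 lf := L2P l; have hgf : in_L2 gf := L2P g.
have hl' n : L2norm (xf n - lf) <= e n by have := hl n; rewrite L2norm_seminorm.
have hg' n : L2norm (dy (xf n) - gf) <= e n by have := hg n; rewrite L2norm_seminorm.
(* Both sides of the defining identity are continuous for L^2 convergence, so the limit of the
   derivatives is a weak derivative of the limit. *)
have lg : weak_derivative lf gf.
  move=> phi hphi; have hp := test_function_in_L2 hphi.
  have hp' := test_function_in_L2 (test_function_derive1 hphi).
  apply/eqP; rewrite -subr_eq0 opprK -normr_eq0 eq_le normr_ge0 andbT.
  apply: (@le0_of_small _ _ (L2norm (derive1 phi) + L2norm phi)) => d /esmall[n hn].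
  have h1 : `|L2inner (xf n - lf) (derive1 phi)| <= d * L2norm (derive1 phi).
    apply: le_trans (L2_CS _ hp') _; first by apply: in_L2B; [exact: (L2P (y n))|exact: hlf].
    apply: ler_wpM2r; first exact: L2norm_ge0.
    exact: le_trans (hl' n) hn.
  have h2 : `|L2inner (dy (xf n) - gf) phi| <= d * L2norm phi.
    apply: le_trans (L2_CS _ hp) _; first by apply: in_L2B; [exact: (L2P (z n))|exact: hgf].
    apply: ler_wpM2r; first exact: L2norm_ge0.
    exact: le_trans (hg' n) hn.
  have wd := (dyP (hx1 n)).2 phi hphi.
  have e1 : L2inner (xf n - lf) (derive1 phi) =
      L2inner (xf n) (derive1 phi) - L2inner lf (derive1 phi).
    rewrite addrC -scaleN1r (L2inner_linl (-1) (L2P l) (L2P (y n)) hp').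
    by rewrite mulN1r addrC.
  have e2 : L2inner (dy (xf n) - gf) phi = L2inner (dy (xf n)) phi - L2inner gf phi.
    rewrite addrC -scaleN1r (L2inner_linl (-1) (L2P g) (L2P (z n)) hp).
    by rewrite mulN1r addrC.
  rewrite e1 wd in h1; rewrite e2 in h2.
  move: h1 h2; rewrite mulrDr.
  set A := L2inner lf _; set C := L2inner (dy _) _; set E := L2inner gf _.
  rewrite !ler_norml => /andP[? ?] /andP[? ?].
  by apply/andP; split; lra.
have hl1 : in_H1 lf := in_H1_intro hlf hgf lg.
have dlg : L2norm (dy lf - gf) = 0 := dy_eq hl1 hgf lg.
have hdist n : H1norm (xf n - lf) <= 2 * e n.
  apply: le_trans (H1norm_le _) _.
  rewrite (L2norm_dyB (hx1 n) hl1 hgf dlg).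
  by rewrite mulr_natl mulr2n; apply: lerD; [exact: hl'|exact: hg'].
have hl10 : in_H10 lf.
  split=> // d d0; have [n hn] := esmall (d / 8) (divr_gt0 d0 (ltr0n R 8)).
  have [_ /(_ _ (divr_gt0 d0 (ltr0n R 2)))[phi [tphi hphi]]] := H10P (x n).
  exists phi; split=> //; have p1 := in_H1_test tphi.
  have h1 := in_H1B hl1 (hx1 n); have h2 := in_H1B (hx1 n) p1.
  rewrite (_ : lf \- phi = (lf - xf n) + (xf n - phi)); last by rewrite subrKA.
  apply: le_lt_trans (H1norm_triangle h1 h2) _.
  rewrite -opprB -scaleN1r (H1normZ _ (in_H1B (hx1 n) hl1)) normrN normr1 mul1r.
  rewrite [ltRHS]splitr; apply: ler_ltD; last exact: hphi.
  by apply: le_trans (hdist n) _; lra.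
exists (toH10 hl10), 2 => n.
by rewrite H10_seminorm; exact: hdist.
Qed.

End SobolevComplete.

(** * The wave equation as a first-order system *)

Section Product.
Variables (R : realType) (V H : lmodType R).
Variables (BV : V -> V -> R) (BH : H -> H -> R).
Hypotheses (hV : semi_inner_product BV) (hH : semi_inner_product BH).

Definition prod_inner (p q : V * H) := BV p.1 q.1 + BH p.2 q.2.

Lemma prod_semi_inner : semi_inner_product prod_inner.
Proof.
split=> [a p q r|p q|p]; rewrite /prod_inner.
- by rewrite (ip_linl hV) (ip_linl hH) mulrDr addrACA.
- by rewrite (ipC hV) (ipC hH).
- by rewrite addr_ge0// ?ip_ge0.
Qed.

Let N := seminorm prod_inner.

Lemma sqr_prod_norm p : N p ^+ 2 = seminorm BV p.1 ^+ 2 + seminorm BH p.2 ^+ 2.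
Proof. by rewrite (sqr_snorm prod_semi_inner) (sqr_snorm hV) (sqr_snorm hH). Qed.

Lemma prod_norm1 p : seminorm BV p.1 <= N p.
Proof.
rewrite -ler_sqr ?nnegrE ?snorm_ge0// sqr_prod_norm.
by rewrite lerDl sqr_ge0.
Qed.

Lemma prod_norm2 p : seminorm BH p.2 <= N p.
Proof.
rewrite -ler_sqr ?nnegrE ?snorm_ge0// sqr_prod_norm.
by rewrite lerDr sqr_ge0.
Qed.

Lemma prod_norm_le p : N p <= seminorm BV p.1 + seminorm BH p.2.
Proof.
rewrite -ler_sqr ?nnegrE ?addr_ge0 ?snorm_ge0// sqr_prod_norm sqrrD.
by have := mulr_ge0 (snorm_ge0 BV p.1) (snorm_ge0 BH p.2); lra.
Qed.

Lemma prod_complete : rate_complete BV -> rate_complete BH -> rate_complete prod_inner.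
Proof.
move=> cV cH; apply: (rate_complete_of_limits prod_semi_inner) => x e es hx.
have [||l hl] := cV (fun n => (x n).1) e => //.
  by move=> n m nm; apply: le_trans (hx n m nm); exact: (prod_norm1 (x m - x n)).
have [||k hk] := cH (fun n => (x n).2) e => //.
  by move=> n m nm; apply: le_trans (hx n m nm); exact: (prod_norm2 (x m - x n)).
exists (l, k), 2 => n; apply: le_trans (prod_norm_le _) _.
by rewrite mulr_natl mulr2n; apply: lerD; [exact: hl|exact: hk].
Qed.

End Product.

(** * The wave operator as a quasi-dissipative relation *)

Section WaveRelation.
Variable R : realType.
Local Notation mu := (@lebesgue_measure R).
Local Notation V := (H10 R).
Local Notation H := (L2 R).
Local Notation BV := (fun u v : V => H1inner u v).
Local Notation BH := (fun f g : H => L2inner f g).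
Let hV : semi_inner_product BV := @H10_semi_inner R.
Let hH : semi_inner_product BH := @L2_semi_inner R.
Local Notation BX := (prod_inner BV BH).
Let hX : semi_inner_product BX := prod_semi_inner hV hH.
Local Notation N := (seminorm BX).

Variable Q : (R -> R) -> R -> R.
Hypothesis Qlin : linear_H1_L2 Q.
Variable b : R.
Hypothesis b1 : 0 <= b.
Hypothesis Qb : forall u, in_H1 u -> L2norm (Q u) <= b * H1norm u.

Lemma in_L2_Q u : in_H1 u -> in_L2 (Q u).
Proof. by case: Qlin => h _ _; exact: h. Qed.

Lemma H10_in_L2 (u : V) : in_L2 u. Proof. exact: in_H1_L2 (H10_H1 u). Qed.
Lemma H10_in_L2_dy (u : V) : in_L2 (dy u). Proof. exact: in_L2_dy (H10_H1 u). Qed.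
Lemma H10_in_L2_op (u : V) : in_L2 (Q u). Proof. exact: in_L2_Q (H10_H1 u). Qed.

Lemma L2inner_Q_lin (a : R) (u v : V) f : in_L2 f ->
  L2inner (Q (a *: u + v)) f = a * L2inner (Q u) f + L2inner (Q v) f.
Proof.
move=> hf; have hu := H10_H1 u; have hv := H10_H1 v.
have [h1 _ h3] := Qlin.
have h4 := in_L2_submod_closed a (H10_in_L2_op u) (H10_in_L2_op v).
rewrite -(L2inner_linl a (H10_in_L2_op u) (H10_in_L2_op v) hf).
have h5 : in_L2 (Q (a *: u + v)) by apply: h1; exact: in_H1_scaleD.
apply: L2inner_congr => //.
apply/L2norm_eq0P; first exact: in_L2B.
apply: ae_imply (h3 a u v hu hv) => y hy yD.
by have := hy yD; rewrite !fctE => ->; rewrite subrr.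
Qed.

(* The form of the operator [u |-> P u - u]: the Dirichlet form is completed
   to the inner product of H^1. *)
Definition lower_form (u w : R -> R) := L2inner (Q u) w - L2inner u w.

Let c := b + 1.
Let c0 : 0 < c. Proof. by rewrite ltr_wpDl. Qed.

Lemma lower_form_le (u w : V) :
  `|lower_form u w| <= c * H1norm u * L2norm w.
Proof.
rewrite /lower_form; apply: le_trans (ler_normB _ _) _.
rewrite /c mulrDl mul1r mulrDl; apply: lerD.
  apply: le_trans (L2_CS (H10_in_L2_op u) (H10_in_L2 w)) _.
  by apply: ler_wpM2r; [exact: L2norm_ge0|exact: Qb (H10_H1 u)].
apply: le_trans (L2_CS (H10_in_L2 u) (H10_in_L2 w)) _.
by apply: ler_wpM2r; [exact: L2norm_ge0|exact: L2norm_le_H1norm].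
Qed.

Lemma lower_form_linl (w : V) : linear_functional (fun u : V => lower_form u w).
Proof.
move=> a u v; rewrite /lower_form.
rewrite (L2inner_Q_lin a u v (H10_in_L2 w)).
rewrite (L2inner_linl a (H10_in_L2 u) (H10_in_L2 v) (H10_in_L2 w)).
by ring.
Qed.

Lemma lower_form_linr (u : V) : linear_functional (fun w : V => lower_form u w).
Proof.
move=> a w v; rewrite /lower_form.
rewrite (L2inner_linr a (H10_in_L2 w) (H10_in_L2 v) (H10_in_L2_op u)).
rewrite (L2inner_linr a (H10_in_L2 w) (H10_in_L2 v) (H10_in_L2 u)).
by ring.
Qed.

(** This is the form <u_y, w_y> + <P u, w> of the equation, split into the inner product of the
    phase space and a part bounded by an L^2 norm in [w]. *)
Definition wave_form (u w : V) := H1inner u w + lower_form u w.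

Lemma wave_form_linl (w : V) : linear_functional (fun u => wave_form u w).
Proof.
move=> a u v; rewrite /wave_form (ip_linl hV w a u v) (lower_form_linl w a u v).
by rewrite addrACA -mulrDr.
Qed.

Lemma wave_form_linr (u : V) : linear_functional (fun w => wave_form u w).
Proof.
move=> a w v; rewrite /wave_form (ip_linr hV u a w v) (lower_form_linr u a w v).
by rewrite addrACA -mulrDr.
Qed.

Lemma wave_form_le (u w : V) : `|wave_form u w| <= (1 + c) * H1norm u * H1norm w.
Proof.
rewrite /wave_form; apply: le_trans (ler_normD _ _) _.
rewrite mulrDl mul1r mulrDl; apply: lerD.
  by have := ip_CS hV u w; rewrite !H10_seminorm.
apply: le_trans (lower_form_le u w) _.
apply: ler_wpM2l; last exact: L2norm_le_H1norm.
by rewrite mulr_ge0 ?sqrtr_ge0// ltW.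
Qed.

(* The first-order system [u' = v, v' = u_yy - P u]. *)
Definition wave_relation (p p' : V * H) :=
  (p.2 : R -> R) = p'.1 /\ forall w : V, wave_form p.1 w = - L2inner p'.2 w.

Lemma wave_relation_lin a p p' q q' : wave_relation p p' -> wave_relation q q' ->
  wave_relation (a *: p + q) (a *: p' + q').
Proof.
move=> [h1 h2] [h3 h4]; split=> [|w].
  by apply/funext => y; rewrite /= !fctE h1 h3.
rewrite (wave_form_linl w a p.1 q.1) h2 h4.
rewrite (L2inner_linl a (L2P p'.2) (L2P q'.2) (H10_in_L2 w)); ring.
Qed.

Lemma wave_relation_diss p p' : wave_relation p p' -> BX p' p <= c * N p ^+ 2.
Proof.
move=> [h1 h2]; have h3 := h2 p'.1.
(* The weak equation is tested with the velocity, which is an admissible test function because it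
   coincides with [p'.1]; the two H^1 inner products cancel. *)
have -> : BX p' p = - lower_form p.1 p'.1.
  apply/eqP; rewrite -addr_eq0 /prod_inner h1 (ipC hV p'.1 p.1) addrAC.
  by rewrite -[X in X + _]/(wave_form p.1 p'.1) h3 addNr.
apply: le_trans (ler_norm _) _; rewrite normrN.
apply: le_trans (lower_form_le p.1 p'.1) _.
rewrite -mulrA expr2; apply: ler_wpM2l; first exact: ltW.
apply: ler_pM.
- exact: sqrtr_ge0.
- exact: L2norm_ge0.
- by rewrite -H10_seminorm; exact: (prod_norm1 hV hH).
- by rewrite -h1 -L2norm_seminorm; exact: (prod_norm2 hV hH).
Qed.

Lemma wave_relation_range h : 0 < h -> h * c <= 2^-1 -> forall z0,
  exists z, wave_relation z (h^-1 *: (z - z0)).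
Proof.
move=> h0 hc [f g].
(* Eliminating the velocity v = (u - f) / h from the resolvent equation leaves h^2 wave_form(u, w) +
   <u, w> = <f + h g, w>. *)
pose a (u w : V) := h ^+ 2 * wave_form u w + L2inner u w.
pose fg : R -> R := h *: (g : R -> R) + (f : R -> R).
have hfg : in_L2 fg := in_L2_submod_closed h (L2P g) (H10_in_L2 f).
have Nge0 (u : V) : 0 <= H1norm u by exact: sqrtr_ge0.
have [|||||||u hu] := @lax_milgram R V BV hV (@H10_complete R) a (h ^+ 2 * (1 + c) + 1)
    (h ^+ 2 / 2) (fun w => L2inner fg w) (L2norm fg).
- move=> u k w v; rewrite /a (wave_form_linr u k w v).
  rewrite (L2inner_linr k (H10_in_L2 w) (H10_in_L2 v) (H10_in_L2 u)); ring.
- move=> w k u v; rewrite /a (wave_form_linl w k u v).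
  rewrite (L2inner_linl k (H10_in_L2 u) (H10_in_L2 v) (H10_in_L2 w)); ring.
- move=> u w; rewrite !H10_seminorm /a; apply: le_trans (ler_normD _ _) _.
  rewrite mulrDl mul1r mulrDl; apply: lerD.
    rewrite normrM ger0_norm ?sqr_ge0//.
    rewrite [leRHS](_ : _ = h ^+ 2 * ((1 + c) * H1norm u * H1norm w)); last by rewrite !mulrA.
    by apply: ler_wpM2l; [exact: sqr_ge0|exact: wave_form_le].
  apply: le_trans (L2_CS (H10_in_L2 u) (H10_in_L2 w)) _.
  by apply: ler_pM; rewrite ?L2norm_ge0 ?L2norm_le_H1norm.
- by rewrite divr_gt0// exprn_gt0.
- move=> u; rewrite H10_seminorm /a /wave_form.
  have := lower_form_le u u; rewrite ler_norml => /andP[h1 _].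
  have h2 : H1inner u u = H1norm u ^+ 2.
    by rewrite -H10_seminorm (sqr_snorm hV).
  have h3 := sqr_L2norm (H10_in_L2 u).
  rewrite h2 -h3; move: h1; move: (lower_form u u) (H1norm u) (L2norm u).
  move=> l x y hl.
  have h4 : h ^+ 2 * - (c * x * y) <= h ^+ 2 * l by rewrite ler_wpM2l ?sqr_ge0.
  (* Young's inequality for the product of h x and h c y: half of the H^1 term absorbs the first
     square, and the smallness of [h * c] lets the L^2 term absorb the second. This leaves the
     coercivity constant h^2 / 2. *)
  have h5 : h ^+ 2 * (c * x * y) <= h ^+ 2 / 2 * x ^+ 2 + (h * c) ^+ 2 * y ^+ 2 / 2.
    by have := sqr_ge0 (h * x - h * c * y); lra.
  have h6 : (h * c) ^+ 2 * y ^+ 2 <= y ^+ 2.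
    by rewrite ler_piMl ?sqr_ge0// expr_le1// ?mulr_ge0 ?(ltW h0) ?(ltW c0)//; lra.
  have := sqr_ge0 y; lra.
- by move=> k w v; exact: (L2inner_linr k (H10_in_L2 w) (H10_in_L2 v) hfg).
- move=> w; rewrite H10_seminorm; apply: le_trans (L2_CS hfg (H10_in_L2 w)) _.
  by apply: ler_wpM2l; [exact: L2norm_ge0|exact: L2norm_le_H1norm].
pose v : H := toL2 (H10_in_L2 (h^-1 *: (u - f))).
exists (u, v); split=> [//|w] /=.
have e1 : L2inner (h^-1 *: (v - g)) w
    = h^-1 * (h^-1 * (L2inner u w - L2inner f w) - L2inner g w).
  rewrite (ipZl hH (toL2 (H10_in_L2 w)) h^-1 (v - g)) (ipBl hH (toL2 (H10_in_L2 w)) v g).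
  congr (_ * (_ - _)).
  have hu2 := H10_in_L2 u; have hf2 := H10_in_L2 f; have hw2 := H10_in_L2 w.
  by have := ipZl hH (toL2 hw2) h^-1 (toL2 hu2 - toL2 hf2); rewrite (ipBl hH).
rewrite e1; have := hu w; rewrite /a /fg (L2inner_linl h (L2P g) (H10_in_L2 f) (H10_in_L2 w)).
move: (wave_form u w) (L2inner u w) (L2inner f w) (L2inner g w) => x y z t hxyz.
have -> : y = h * t + z - h ^+ 2 * x by lra.
by field; rewrite gt_eqF.
Qed.

Lemma wave_relation_test phi (tphi : test_function phi) :
  exists p', wave_relation (toH10 (test_function_H10 tphi), 0) p'.
Proof.
set p : V := toH10 _.
have t1 := test_function_derive1 tphi; have t2 := test_function_derive1 t1.
have h1 := test_function_in_L2 tphi; have h2 := test_function_in_L2 t1.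
have h3 := test_function_in_L2 t2; have hq := in_L2B h3 (H10_in_L2_op p).
exists (0, toL2 hq); split=> [//|w] /=.
have e1 : L2inner (dy phi) (dy w) = - L2inner (derive1 (derive1 phi)) w.
  rewrite (L2inner_congr (H10_in_L2_dy p) h2 (H10_in_L2_dy w) (dy_test tphi)).
  have := (dyP (H10_H1 w)).2 _ t1.
  rewrite (L2innerC (derive1 (derive1 phi))) => ->.
  by rewrite opprK L2innerC.
have e2 : L2inner (derive1 (derive1 phi) - Q p) w
    = L2inner (derive1 (derive1 phi)) w - L2inner (Q p) w.
  by have := ipBl hH (toL2 (H10_in_L2 w)) (toL2 h3) (toL2 (H10_in_L2_op p)).
rewrite /wave_form /H1inner /lower_form e1 e2.
move: (L2inner phi w) (L2inner (derive1 (derive1 phi)) w) (L2inner (Q p) w).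
by move=> x y z; ring.
Qed.

Lemma wave_flow (u0 : V) : exists Z, flow BX wave_relation Z /\ N (Z 0 - (u0, 0)) = 0.
Proof.
have cX : rate_complete BX.
  exact: (prod_complete hV hH (@H10_complete R) (@L2_complete R)).
have [|Z hZ hZ0] := @flow_exists R _ BX hX wave_relation c c0 wave_relation_lin
    wave_relation_diss wave_relation_range cX (u0, 0).
  move=> d d0; have [_ /(_ d d0)[phi [tphi hphi]]] := H10P u0.
  have [p' hp'] := wave_relation_test tphi.
  exists (toH10 (test_function_H10 tphi), 0), p'; split=> //.
  apply: le_trans (prod_norm_le hV hH _) _; rewrite /= subrr (snorm0 hH) addr0.
  rewrite (snormBC hV); apply: le_trans (ltW hphi).
  by rewrite H10_seminorm.
by exists Z.
Qed.

End WaveRelation.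

(** * The flow is a weak solution *)

Section WaveSolution.
Variable R : realType.
Local Notation mu := (@lebesgue_measure R).
Local Notation V := (H10 R).
Local Notation H := (L2 R).
Local Notation BV := (fun u v : V => H1inner u v).
Local Notation BH := (fun f g : H => L2inner f g).
Let hV : semi_inner_product BV := @H10_semi_inner R.
Let hH : semi_inner_product BH := @L2_semi_inner R.
Local Notation BX := (prod_inner BV BH).
Let hX : semi_inner_product BX := prod_semi_inner hV hH.
Local Notation N := (seminorm BX).

Variable Q : (R -> R) -> R -> R.
Hypothesis Qlin : linear_H1_L2 Q.
Variable b : R.
Hypothesis b1 : 0 <= b.
Hypothesis Qb : forall u, in_H1 u -> L2norm (Q u) <= b * H1norm u.

Variable Z : R -> V * H.
Hypothesis hZ : flow BX (wave_relation Q) Z.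

Let u (x : R) : R -> R := (Z x).1.
Let ux (x : R) : R -> R := (Z x).2.
Let M := 1 + (b + 1).
Let M0 : 0 <= M. Proof. by rewrite /M; have := b1; lra. Qed.

Lemma H10_val_linear a (p q : V) :
  (a *: p + q : V) = a *: (p : R -> R) + (q : R -> R) :> (R -> R).
Proof. by []. Qed.

Lemma H1norm_flow x y : H1norm (u x \- u y) <= N (Z x - Z y).
Proof.
have := prod_norm1 hV hH (Z x - Z y).
by rewrite H10_seminorm.
Qed.

Lemma L2norm_flow x y : L2norm (ux x \- ux y) <= N (Z x - Z y).
Proof.
have := prod_norm2 hV hH (Z x - Z y).
by rewrite L2norm_seminorm.
Qed.

Lemma flow_near (x e : R) : x \in `[0, 1] -> 0 < e ->
  \forall s \near nbhs x, `[0, 1]%classic s -> N (Z s - Z x) <= e.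
Proof.
move=> x01 e0; have hx : 0 <= x <= 1 by move: x01; rewrite in_itv.
have [d d0 hd] := hZ.1 x e hx e0.
exists d => //= s; rewrite /ball/= distrC => sd; rewrite in_itv/= => hs.
by apply: hd => //; exact: ltW.
Qed.

Lemma in_C01_u : in_C01 (@in_H10 R) (@H1norm R) u.
Proof.
move=> x x01; split; first exact: H10P.
apply/cvgr0Pnorm_le => e e0; rewrite near_withinE.
apply: filterS (flow_near x01 e0) => s hs s01.
by rewrite ger0_norm ?sqrtr_ge0//; exact: le_trans (H1norm_flow s x) (hs s01).
Qed.

Lemma in_C01_ux : in_C01 (@in_L2 R) (@L2norm R) ux.
Proof.
move=> x x01; split; first exact: L2P.
apply/cvgr0Pnorm_le => e e0; rewrite near_withinE.
apply: filterS (flow_near x01 e0) => s hs s01.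
by rewrite ger0_norm ?L2norm_ge0//; exact: le_trans (L2norm_flow s x) (hs s01).
Qed.

Lemma dx_dual (f : H) : dual_pair BX (wave_relation Q) (L2norm f)
  (fun p => L2inner p.1 f) (fun p => L2inner p.2 f).
Proof.
have bd (p : V * H) : L2norm p.1 <= N p.
  apply: le_trans (L2norm_le_H1norm _) _.
  by rewrite -H10_seminorm; exact: (prod_norm1 hV hH).
split.
- exists (L2norm f); split=> [a p q||p]; last 1 first.
  + rewrite mulrC; apply: le_trans (L2_CS (H10_in_L2 p.1) (L2P f)) _.
    by apply: ler_wpM2r; [exact: L2norm_ge0|exact: bd].
  + by rewrite -(L2inner_linl a (H10_in_L2 p.1) (H10_in_L2 q.1) (L2P f)) -H10_val_linear.
  + exact: L2norm_ge0.
- split=> [a p q||p]; last 1 first.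
  + rewrite mulrC; apply: le_trans (L2_CS (L2P p.2) (L2P f)) _.
    apply: ler_wpM2r; first exact: L2norm_ge0.
    by rewrite -L2norm_seminorm; exact: (prod_norm2 hV hH).
  + exact: (ip_linl hH f a p.2 q.2).
  + exact: L2norm_ge0.
- by move=> p p' [h _]; rewrite -h.
Qed.

Lemma is_dx_u : is_dx u ux.
Proof.
move=> x x01; have hx : 0 <= x <= 1 by move: x01; rewrite in_itv.
apply/cvgr0Pnorm_le => e e0; rewrite near_withinE.
have [d d0 hd] := flow_differentiable hX hZ hx e0.
have : \forall s \near nbhs x, `|s - x| <= d.
  by exists d => //= s; rewrite /ball/= distrC; exact: ltW.
rewrite -nbhs_nearE => hnear.
apply: filterS (hnear) => s sd sx /=; rewrite in_itv/= => hs.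
rewrite ger0_norm ?L2norm_ge0//.
have hus := H10_in_L2 (Z s).1; have hux := H10_in_L2 (Z x).1; have hv := L2P (Z x).2.
have h1 := in_L2B hus hux.
have hf : in_L2 (u s - u x - (s - x) *: ux x).
  have := in_L2_submod_closed (- (s - x)) hv h1.
  by rewrite scaleNr addrC.
(* The functional is the pairing with the remainder of the first-order expansion itself, hence
   depends on [s]. The estimate then reads |f|^2 <= |s - x| |f| e, and one factor of the norm is
   divided out. *)
pose f : H := toL2 hf.
have -> : (fun y => (u s y - u x y) / (s - x) - ux x y)
    = (s - x)^-1 *: (u s - u x - (s - x) *: ux x).
  apply/funext => y; rewrite !fctE /GRing.scale/=.
  by field; rewrite subr_eq0.
have -> : L2norm ((s - x)^-1 *: (u s - u x - (s - x) *: ux x))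
    = `|s - x|^-1 * L2norm f.
  have := snormZ hH (s - x)^-1 f.
  by rewrite !L2norm_seminorm normfV.
have sx0 : 0 < `|s - x| by rewrite normr_gt0 subr_eq0.
rewrite -ler_pdivlMl ?invr_gt0// invrK.
have := hd s hs sd _ _ _ (dx_dual f).
have -> : L2inner (Z s).1 f - L2inner (Z x).1 f - (s - x) * L2inner (Z x).2 f
    = L2norm f ^+ 2.
  rewrite sqr_L2norm; last exact: L2P.
  have e1 := L2inner_linl (- (s - x)) hv h1 (L2P f).
  have e2 := ipBl hH f (toL2 hus) (toL2 hux).
  have -> : L2inner f f = L2inner (- (s - x) *: ux x + (u s - u x)) f.
    by congr (L2inner _ f); rewrite scaleNr [RHS]addrC.
  rewrite e1 mulNr [RHS]addrC; congr (_ - _); exact: esym e2.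
rewrite ger0_norm ?sqr_ge0// expr2.
have [->|f0] := eqVneq (L2norm f) 0.
  by move=> _; rewrite mulr_ge0// ltW.
have fp : 0 < L2norm f by rewrite lt_neqAle eq_sym f0 L2norm_ge0.
by rewrite [L2norm f * e]mulrC mulrA ler_pM2r.
Qed.

Definition wave_dxx (x : R) (psi : R -> R) : R :=
  - L2inner (dy (u x)) (dy psi) - L2inner (Q (u x)) psi.

Lemma wave_dxxE x (w : V) : wave_dxx x w = - wave_form Q (Z x).1 w.
Proof.
rewrite /wave_form /H1inner /lower_form /wave_dxx -/(u x).
move: (L2inner (dy (u x)) _) (L2inner (u x) _) (L2inner (Q (u x)) _) => p q r.
by ring.
Qed.

(** The velocity may be tested only against H_0^1: its image under the relation is controlled by the
    form, whose bound involves the H^1 norm of [w]. *)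
Lemma dxx_dual (w : V) : dual_pair BX (wave_relation Q) (M * H1norm w)
  (fun p => L2inner p.2 w) (fun p => - wave_form Q p.1 w).
Proof.
have Nw : 0 <= H1norm w by exact: sqrtr_ge0.
split.
- exists (L2norm w); split=> [a p q||p].
  + exact: (ip_linl hH (toL2 (H10_in_L2 w)) a p.2 q.2).
  + exact: L2norm_ge0.
  + rewrite mulrC; apply: le_trans (L2_CS (L2P p.2) (H10_in_L2 w)) _.
    apply: ler_wpM2r; first exact: L2norm_ge0.
    by rewrite -L2norm_seminorm; exact: (prod_norm2 hV hH).
- split=> [a p q||p].
  + by rewrite (wave_form_linl Qlin w a p.1 q.1) opprD mulrN.
  + exact: mulr_ge0.
  + rewrite normrN; apply: le_trans (wave_form_le Qlin b1 Qb p.1 w) _.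
    rewrite mulrAC; apply: ler_wpM2l; first exact: mulr_ge0.
    by rewrite -H10_seminorm; exact: (prod_norm1 hV hH).
- by move=> p p' [_ h]; rewrite h opprK.
Qed.

Lemma wave_dxx_dist x y (w : V) :
  `|wave_dxx x w - wave_dxx y w| <= M * H1norm w * N (Z x - Z y).
Proof.
have [_ [lin _ h] _] := dxx_dual w.
by rewrite !wave_dxxE -(lfunB lin); exact: h.
Qed.

Lemma flow_within_continuous (f : R -> R) (c : R) : 0 <= c ->
  (forall s t, `|f s - f t| <= c * N (Z s - Z t)) ->
  {within `[0, 1], continuous f}.
Proof.
move=> c0 hf; apply/subspace_continuousP => x x01.
apply/cvgrPdist_le => e e0; rewrite near_withinE.
have c1 : 0 < c + 1 by rewrite ltr_wpDl.
apply: filterS (flow_near x01 (divr_gt0 e0 c1)) => s hs s01.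
apply: le_trans (hf x s) _; have := hs s01; rewrite ler_pdivlMr// => h.
apply: le_trans h; rewrite (snormBC hX) mulrC ler_wpM2l ?snorm_ge0//.
by rewrite lerDl.
Qed.

Lemma dxx_derivative (w : V) (x : R) : 0 < x < 1 ->
  is_derive x 1 (fun s => L2inner (ux s) w) (wave_dxx x w).
Proof.
move=> /andP[x0 x1]; have hx : 0 <= x <= 1 by rewrite !ltW.
set f := fun s => L2inner (ux s) w; rewrite wave_dxxE.
have key : h^-1 *: (f (h *: 1 + x) - f x) @[h --> 0^'] --> - wave_form Q (Z x).1 w.
  apply/cvgrPdist_le => e e0.
  pose C := M * H1norm w.
  have C0 : 0 <= C by rewrite mulr_ge0// sqrtr_ge0.
  have C1 : 0 < C + 1 by rewrite ltr_wpDl.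
  have [d d0 hd] := flow_differentiable hX hZ hx (divr_gt0 e0 C1).
  near=> h.
  have h0 : h != 0 by near: h; exact: nbhs_dnbhs_neq.
  have hdh : `|h| <= d by near: h; exact: dnbhs0_le.
  have hxh : `|h| <= x by near: h; exact: dnbhs0_le.
  have hx1 : `|h| <= 1 - x by near: h; apply: dnbhs0_le; rewrite subr_gt0.
  have hh : 0 <= h + x <= 1.
    by move: hxh hx1; rewrite !ler_norml => /andP[? ?] /andP[? ?]; apply/andP; split; lra.
  have := hd (h + x) hh; rewrite addrK => /(_ hdh _ _ _ (dxx_dual w)).
  rewrite -/C -[L2inner (Z (h + x)).2 w]/(f (h + x)) -[L2inner (Z x).2 w]/(f x).
  rewrite /GRing.scale/= mulr1; move: (f (h + x)) (f x) (- wave_form _ _ _).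
  move=> F1 F0 W hk.
  have hp : 0 < `|h| by rewrite normr_gt0.
  have -> : W - h^-1 * (F1 - F0) = - h^-1 * (F1 - F0 - h * W) by field.
  rewrite normrM normrN normfV ler_pdivrMl//; apply: le_trans hk _.
  rewrite ler_pM2l// mulrA ler_pdivrMr// mulrDr mulr1 mulrC lerDl.
  exact: ltW.
apply: DeriveDef; first by apply/cvg_ex; exists (- wave_form Q (Z x).1 w); exact: key.
by apply/cvg_lim => //; exact: key.
Unshelve. all: by end_near. Qed.

(** For a fixed [psi], the pairing with [ux] is a scalar function, differentiable inside the
    interval and continuous up to its ends, with continuous derivative, so classical integration by
    parts applies. *)
Lemma is_weak_dx_ux : is_weak_dx ux wave_dxx.
Proof.
move=> phi psi tphi hpsi; pose w : V := toH10 hpsi.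
have sphi := test_function_smooth tphi.
have cphi := smooth_continuous sphi.
have cphi' := smooth_continuous (smooth_derive1 sphi).
pose f s := L2inner (ux s) psi; pose k s := wave_dxx s psi.
have cf : {within `[0, 1], continuous f}.
  apply: (@flow_within_continuous _ (L2norm psi)); first exact: L2norm_ge0.
  move=> s t.
  have := ipBl hH (toL2 (H10_in_L2 w)) (Z s).2 (Z t).2.
  rewrite -[L2inner (Z s).2 _]/(f s) -[L2inner (Z t).2 _]/(f t) => <-.
  apply: le_trans (L2_CS (L2P _) (H10_in_L2 w)) _; rewrite mulrC.
  by apply: ler_wpM2l; [exact: L2norm_ge0|exact: L2norm_flow].
have ck : {within `[0, 1], continuous k}.
  apply: (@flow_within_continuous _ (M * H1norm psi)).
    by rewrite mulr_ge0// sqrtr_ge0.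
  by move=> s t; exact: (wave_dxx_dist s t w).
have df (s : R) : s \in `]0, 1[ -> is_derive s 1 f (k s).
  by rewrite in_itv => hs; exact: (dxx_derivative w hs).
have LRf : derivable_oo_LRcontinuous f 0 1.
  have [_ f0 f1] := (continuous_within_itvP f (@ltr01 R)).1 cf.
  by split=> // s hs; have := df s hs; case.
have n0 : ~ `]0, 1[%classic (0 : R) by rewrite /= in_itv/= ltxx.
have n1 : ~ `]0, 1[%classic (1 : R) by rewrite /= in_itv/= ltxx andbF.
have wM (g h : R -> R) : {within `[0, 1], continuous g} ->
    {within `[0, 1], continuous h} -> {within `[0, 1], continuous (g \* h)}.
  by move=> cg ch s; apply: continuousM; [exact: cg|exact: ch].
have cphi01 := continuous_subspaceT cphi; have cphi01' := continuous_subspaceT cphi'.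
rewrite (Rintegral_oo_cc (wM _ _ (cphi01' _) cf)) (Rintegral_oo_cc (wM _ _ (cphi01 _) ck)).
have := @Rintegration_by_parts R f phi k (derive1 phi) 0 1 ltr01 ck LRf.
rewrite !(test_function_out tphi) // !mulr0 subrr sub0r => h.
transitivity (\int[mu]_(x in `[0, 1]) (f x * derive1 phi x)).
  by apply: eq_Rintegral => s _; exact: mulrC.
rewrite h.
- by congr (- _); apply: eq_Rintegral => s _; exact: mulrC.
- by move=> s hs; have := df s hs; rewrite derive1E => ?; rewrite derive_val.
- exact: cphi01'.
- by apply: derivable_LRcontinuous => y; case: sphi => /(_ 0%N y).
- by [].
Qed.

Lemma wave_dxx_Hm1 x : in_Hm1 (wave_dxx x).
Proof.
split=> [a psi1 psi2 h1 h2|].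
  have := wave_form_linr Qlin (Z x).1 a (toH10 h1) (toH10 h2).
  have -> := wave_dxxE x (toH10 h1); have -> := wave_dxxE x (toH10 h2).
  have -> := wave_dxxE x (a *: toH10 h1 + toH10 h2) => ->.
  by ring.
exists (M * H1norm (u x)) => psi hpsi.
by rewrite (wave_dxxE x (toH10 hpsi)) normrN; exact: (wave_form_le Qlin b1 Qb).
Qed.

Lemma Hm1norm_le (F : (R -> R) -> R) (c : R) :
  (forall psi, in_H10 psi -> H1norm psi <= 1 -> `|F psi| <= c) ->
  0 <= Hm1norm F <= c.
Proof.
move=> hc; set S := [set psi : R -> R | in_H10 psi /\ H1norm psi <= 1].
have ubS : ubound [set `|F psi| | psi in S] c by move=> _ [psi [h1 h2] <-]; exact: hc.
(* A supremum is controlled by an upper bound only on a nonempty set; the zero function provides a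
   member and the lower bound 0. *)
have h0 : S 0.
  have t0 := test_function_H10 (@test_function0 R).
  split=> //.
  have -> : H1norm (0 : R -> R) = 0 by have := snorm0 hV; rewrite H10_seminorm.
  exact: ler01.
have ne : [set `|F psi| | psi in S] !=set0 by exists `|F 0|, 0.
apply/andP; split; last exact: ge_sup.
apply: le_trans (normr_ge0 (F 0)) _; apply: ub_le_sup; first by exists c.
by exists 0.
Qed.

Lemma Hm1norm_dxx_dist x y :
  0 <= Hm1norm (fun psi => wave_dxx x psi - wave_dxx y psi) <= M * N (Z x - Z y).
Proof.
apply: Hm1norm_le => psi hpsi psi1.
apply: le_trans (wave_dxx_dist x y (toH10 hpsi)) _.
rewrite mulrAC ler_piMr//; rewrite mulr_ge0//; exact: snorm_ge0.
Qed.

Lemma ler_Hm1norm (F : (R -> R) -> R) psi : in_Hm1 F -> in_H10 psi ->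
  H1norm psi <= 1 -> `|F psi| <= Hm1norm F.
Proof.
move=> [_ [c hc]] hpsi psi1; apply: ub_le_sup; last by exists psi.
exists `|c| => _ [phi [h1 h2] <-]; apply: le_trans (hc phi h1) _.
apply: le_trans (_ : `|c| * H1norm phi <= _).
  by apply: ler_wpM2r; [exact: sqrtr_ge0|exact: ler_norm].
by rewrite ler_piMr.
Qed.

Lemma Hm1norm_dxx_lipschitz x y :
  `|Hm1norm (wave_dxx x) - Hm1norm (wave_dxx y)| <= M * N (Z x - Z y).
Proof.
have le_xy s t : Hm1norm (wave_dxx s) <= Hm1norm (wave_dxx t) + M * N (Z s - Z t).
  suff /andP[_] : 0 <= Hm1norm (wave_dxx s) <=
      Hm1norm (wave_dxx t) + M * N (Z s - Z t) by [].
  apply: Hm1norm_le => psi hpsi psi1.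
  rewrite -[wave_dxx s psi](subrK (wave_dxx t psi)) addrC.
  apply: le_trans (ler_normD _ _) _; apply: lerD.
    exact: (ler_Hm1norm (wave_dxx_Hm1 t)).
  apply: le_trans (wave_dxx_dist s t (toH10 hpsi)) _.
  by rewrite mulrAC ler_piMr// mulr_ge0//; exact: snorm_ge0.
rewrite ler_norml lerBlDl le_xy andbT lerNl opprB lerBlDl (snormBC hX).
exact: le_xy.
Qed.

(** The functional depends continuously on [x] in H^{-1}, through the continuity of [Z]. Strong
    measurability follows by sampling on uniform partitions, and square integrability from
    continuity of the norm on the closed interval. *)
Lemma in_L2_Hm1_dxx : in_L2_Hm1 wave_dxx.
Proof.
split=> [x _||]; first exact: wave_dxx_Hm1.
  pose A n i : set (measurableTypeR R) := `[i%:R / n.+1%:R, i.+1%:R / n.+1%:R[%classic.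
  pose S n x psi : R := \sum_(i < n.+1) \1_(A n i) x * wave_dxx (i%:R / n.+1%:R) psi.
  exists S; split=> [n|].
    exists n.+1, (A n), (fun i => wave_dxx (i%:R / n.+1%:R)).
    by split=> [i|i|//]; [exact: measurable_itv|exact: wave_dxx_Hm1].
  apply: aeW => x; rewrite in_itv/= => /andP[x0 x1].
  pose y n : R := (Num.truncn (x * n.+1%:R))%:R / n.+1%:R.
  have n0 n : 0 < n.+1%:R :> R by [].
  have yx n : y n <= x /\ x - y n <= n.+1%:R^-1.
    have /truncn_itv/andP[h1 h2] : 0 <= x * n.+1%:R by rewrite mulr_ge0// ltW.
    split; first by rewrite ler_pdivrMr.
    rewrite lerBlDr -[X in X + _]mul1r -mulrDl ler_pdivlMr//.
    by rewrite addrC natr1 ltW.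
  have Sy n : S n x = wave_dxx (y n).
    have /truncn_itv/andP[h1 h2] : 0 <= x * n.+1%:R by rewrite mulr_ge0// ltW.
    (* As x < 1, its cell is among the first [n.+1] ones; the cells being half-open, exactly one
       indicator is nonzero and the sum is the value at the left end [y n]. *)
    have hk : (Num.truncn (x * n.+1%:R) < n.+1)%N.
      by rewrite truncn_lt_nat ?mulr_ge0 ?(ltW x0)// gtr_pMl.
    apply/funext => psi; rewrite /S (bigD1 (Ordinal hk))//= big1 ?addr0.
      rewrite indicE mem_set ?mul1r// /A/= in_itv/=.
      by rewrite ler_pdivrMr// ltr_pdivlMr// h1 h2.
    move=> i ik; rewrite indicE memNset ?mul0r// /A/= in_itv/=.
    rewrite ler_pdivrMr// ltr_pdivlMr// -truncn_eq ?mulr_ge0 ?(ltW x0)//.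
    by apply/negP; apply: contra ik => /eqP h; apply/eqP/val_inj.
  under eq_fun do rewrite Sy.
  apply/cvgr0Pnorm_le => e e0.
  have hx : 0 <= x <= 1 by rewrite !ltW.
  have M1 : 0 < M + 1 by rewrite ltr_wpDl.
  have [d d0 hd] := hZ.1 x (e / (M + 1)) hx (divr_gt0 e0 M1).
  near=> n.
  have [y1 y2] := yx n.
  have /andP[h1 h2] := Hm1norm_dxx_dist (y n) x.
  rewrite ger0_norm//; apply: le_trans h2 _.
  have : N (Z (y n) - Z x) <= e / (M + 1).
    apply: hd.
      by rewrite divr_ge0//= (le_trans y1)// ltW.
    rewrite distrC ger0_norm ?subr_ge0//; apply: le_trans y2 _.
    near: n; exists (Num.truncn d^-1) => // n /= hn.
    rewrite invf_ple ?posrE//; apply: ltW; apply: lt_le_trans (truncnS_gt _) _.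
    by rewrite ler_nat ltnS.
  rewrite ler_pdivlMr// => h3; apply: le_trans h3.
  by rewrite mulrC ler_wpM2l ?snorm_ge0// lerDl.
pose c x := Hm1norm (wave_dxx x).
have cc : {within `[0, 1], continuous c}.
  by apply: (flow_within_continuous M0) => s t; exact: Hm1norm_dxx_lipschitz.
have icc : mu.-integrable `[0, 1] (EFin \o (fun x => c x ^+ 2)).
  apply: continuous_compact_integrable; first exact: segment_compact.
  by move=> s; apply: continuousM; exact: cc.
have : mu.-integrable `]0, 1[ (EFin \o (fun x => c x ^+ 2)).
  by apply: integrableS icc => //; exact: subset_itv_oo_cc.
move=> /integrableP[_]; apply: le_lt_trans.
rewrite le_eqVlt; apply/orP; left; apply/eqP/eq_integral => s _.
by rewrite /= ger0_norm// sqr_ge0.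
Unshelve. all: by end_near. Qed.

Lemma flow_weak_solution (u0 : V) : N (Z 0 - (u0, 0)) = 0 -> weak_solution Q u0 u.
Proof.
move=> Z0; exists ux, wave_dxx; split.
- exact: in_C01_u.
- by split; [exact: is_dx_u|exact: in_C01_ux].
- by split; [exact: is_weak_dx_ux|exact: in_L2_Hm1_dxx].
- move=> psi hpsi; apply: aeW => x _; rewrite /wave_dxx.
  move: (L2inner (dy (u x)) _) (L2inner (Q (u x)) _) => p q; lra.
have h1 : L2norm (u 0 - u0) = 0.
  apply/eqP; rewrite eq_le L2norm_ge0 andbT.
  apply: le_trans (L2norm_le_H1norm _) _.
  have := prod_norm1 hV hH (Z 0 - (u0, 0)).
  by rewrite H10_seminorm Z0.
have h2 : L2norm (ux 0) = 0.
  apply/eqP; rewrite eq_le L2norm_ge0 andbT.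
  have := prod_norm2 hV hH (Z 0 - (u0, 0)).
  by rewrite Z0 /= subr0 L2norm_seminorm.
split; last by apply/L2norm_eq0P => //; exact: L2P.
have h3 : in_L2 (u 0 - u0) by apply: in_L2B; exact: H10_in_L2.
have := (L2norm_eq0P h3).1 h1; apply: ae_imply => y hy yD.
by apply/eqP; rewrite -subr_eq0; apply/eqP; exact: hy.
Qed.

End WaveSolution.

(** A solution with values in H_0^1 on the closed interval has its initial value there, and
    membership in H_0^1 is invariant under almost everywhere equality: the compatibility condition
    [Hcompat] on the datum is therefore forced. The operator bound [C1 * ln (gamma (beta eps))]
    plays the role of [b]; it is nonnegative because [gamma] is at least 1. *)
Theorem theorem3p3 (R : realType) (gamma beta : R -> R)
  (gamma_ge1 : forall b : R, 0 < b < 1 -> 1 <= gamma b)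
  (gamma_cvg : gamma b @[b --> 0^'+] --> +oo)
  (beta01 : forall e : R, 0 < e < 1 -> 0 < beta e < 1)
  (beta_cvg : beta e @[e --> 0^'+] --> (0 : R))
  (P : R -> (R -> R) -> R -> R)
  (HP : stabilized_operators gamma beta P)
  (u0 : R -> R) (Hu0 : in_H1 u0)
  (eps : R) (Heps : 0 < eps < 1)
  (u0eps : R -> R) (Hu0eps : in_H1 u0eps)
  (Hclose : H1norm (u0eps \- u0) <= eps)
  (Hcompat : in_H10 u0eps) :
  exists u : R -> R -> R,
    weak_solution (P eps) u0eps u /\
    in_C01 (@in_H10 R) (@H1norm R) u /\
    exists ux : R -> R -> R, is_dx u ux /\ in_C01 (@in_L2 R) (@L2norm R) ux.
Proof.
have [C1 C1_gt0 /(_ eps Heps)[Plin Pb]] := HP.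
have b0 : 0 <= C1 * ln (gamma (beta eps)).
  by rewrite mulr_ge0 ?(ltW C1_gt0)// ln_ge0// gamma_ge1// beta01.
have [Z [hZ Z0]] := wave_flow Plin b0 Pb (toH10 Hcompat).
have hw := flow_weak_solution Plin b0 Pb hZ Z0.
exists (fun x => (Z x).1 : R -> R); split; first exact: hw.
by have [ux [uxx [h1 h2 _ _ _]]] := hw; split=> //; exists ux.
Qed.
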